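(* Let $\varphi(s)=\sum_{n=1}^\infty c_nn^{-s}$ be the symbol of a bounded composition operator $C_\varphi$ on $\mathcal{H}^2$ such that the closure of $\varphi(\mathbb{C}_0)$ is a compact subset of $\mathbb{C}_{1/2}$. Then there exist $0<r<1$ and a constant $C$ such that $a_n(C_\varphi)\le C r^n$ for all $n\ge1$.
   Context: $\mathbb{C}_\theta=\{s\in\mathbb{C}:\operatorname{Re}s>\theta\}$. $\mathcal{H}^2$ is the Hilbert space of Dirichlet series $f(s)=\sum_{n\ge1} b_n n^{-s}$ with $\|f\|_{\mathcal{H}^2}^2=\sum_n |b_n|^2<\infty$, analytic in $\mathbb{C}_{1/2}$, and $C_\varphi f=f\circ\varphi$. The symbol $\varphi$ is a Dirichlet series converging uniformly in $\mathbb{C}_\varepsilon$ for every $\varepsilon>0$ (as is automatic for symbols of bounded composition operators, by the Gordon-Hedenmalm theorem). The $n$th approximation number $a_n(T)$ of a bounded operator $T$ is the distance in operator norm from $T$ to the set of operators of rank $<n$. *)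

(* Defs.v *)
From Stdlib Require Import Reals Lra List.
From Stdlib Require Import FunctionalExtensionality ProofIrrelevance.
From Coquelicot Require Export Coquelicot.
Open Scope R_scope.

(** ** Topology *)

Definition closure_set {U : UniformSpace} (D : U -> Prop) : U -> Prop :=
  fun x => forall e : posreal, exists y, ball x e y /\ D y.

Definition compact_set {U : UniformSpace} (K : U -> Prop) : Prop :=
  forall F : (U -> Prop) -> Prop,
    (forall O, F O -> open O) ->
    (forall x, K x -> exists O, F O /\ O x) ->
    exists l : list (U -> Prop),
      List.Forall F l /\ forall x, K x -> List.Exists (fun O => O x) l.

(** ** Approximation numbers of a bounded operator *)

Definition op_norm {K : AbsRing} {U V : NormedModule K} (T : U -> V) : Rbar :=
  Lub_Rbar (fun y => exists x : U, norm x <= 1 /\ y = norm (T x)).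

(** [rank_lt S n]: the range of [S] is spanned by [m < n] of its own vectors
    ([sum_n_m _ 1 m] is the empty sum when [m = 0]). *)
Definition rank_lt {K : AbsRing} {U V : NormedModule K} (S : U -> V) (n : nat)
  : Prop :=
  exists (m : nat) (e : nat -> U), (m < n)%nat /\
    forall x : U, exists a : nat -> K,
      S x = sum_n_m (fun i => scal (a i) (S (e i))) 1 m.

(** Coquelicot's [is_linear] is linearity together with boundedness. *)
Definition approx_num {K : AbsRing} {U V : NormedModule K} (T : U -> V)
  (n : nat) : Rbar :=
  Glb_Rbar (fun d => exists S : U -> V,
    is_linear S /\ rank_lt S n /\
    op_norm (fun x => minus (T x) (S x)) = Finite d).

(** ** Dirichlet series *)

Definition halfplane (theta : R) (s : C) : Prop := theta < Re s.

Definition Cexp (z : C) : C :=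
  (exp (Re z) * cos (Im z), exp (Re z) * sin (Im z)).

(** A Dirichlet series is given by its coefficients, with indices shifted by
    one: [b k] is the coefficient of [(k+1)^(-s)]. *)
Definition dirichlet_term (b : nat -> C) (s : C) (k : nat) : C :=
  Cmult (b k) (Cexp (Cmult (Copp s) (RtoC (ln (INR (S k)))))).

(** The sum of the series; meaningful only where the series converges. *)
Definition dirichlet (b : nat -> C) (s : C) : C :=
  (Series (fun k => Re (dirichlet_term b s k)),
   Series (fun k => Im (dirichlet_term b s k))).

(** On a nonempty [D] this forces pointwise convergence as well: the partial
    sums converge to the value of [dirichlet b], so that value is the sum. *)
Definition dirichlet_cv_unif (b : nat -> C) (D : C -> Prop) : Prop :=
  forall delta, 0 < delta -> exists N : nat, forall n s, (N <= n)%nat -> D s ->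
    Cmod (Cminus (sum_n (dirichlet_term b s) n) (dirichlet b s)) < delta.

(** ** The space H^2, as a normed space over C *)

Record H2 : Type := mkH2 {
  coef :> nat -> C;
  coef_sq_summable : ex_series (fun k => Cmod (coef k) ^ 2)
}.

Definition H2_norm (f : H2) : R := sqrt (Series (fun k => Cmod (f k) ^ 2)).

Definition H2_eval (f : H2) (s : C) : C := dirichlet (coef f) s.

Lemma H2_ext (f g : H2) : (forall k, f k = g k) -> f = g.
Proof.
  destruct f as [a ha], g as [b hb]; simpl; intros H.
  assert (E : a = b) by (apply functional_extensionality; exact H).
  subst b; f_equal; apply proof_irrelevance.
Qed.

Lemma Cmod_sq_plus (x y : C) :
  0 <= Cmod (Cplus x y) ^ 2 <= 2 * (Cmod x ^ 2 + Cmod y ^ 2).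
Proof.
  pose proof (Cmod_triangle x y); pose proof (Cmod_ge_0 (Cplus x y)).
  pose proof (Cmod_ge_0 x); pose proof (Cmod_ge_0 y).
  split; [nra|].
  apply Rle_trans with ((Cmod x + Cmod y) ^ 2).
  - apply pow_incr; lra.
  - pose proof (pow2_ge_0 (Cmod x - Cmod y)); nra.
Qed.

Lemma ex_series_nonneg_le (a b : nat -> R) :
  (forall n, 0 <= a n <= b n) -> ex_series b -> ex_series a.
Proof.
  intros H; apply (@ex_series_le R_AbsRing R_CompleteNormedModule).
  intros n; change (Rabs (a n) <= b n).
  rewrite Rabs_pos_eq; apply H.
Qed.

Definition H2_plus (f g : H2) : H2.
Proof.
  exists (fun k => Cplus (f k) (g k)).
  apply (ex_series_nonneg_le _ (fun k => 2 * (Cmod (f k) ^ 2 + Cmod (g k) ^ 2))).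
  - intros n; apply Cmod_sq_plus.
  - apply (ex_series_scal (V := R_NormedModule) 2).
    apply (ex_series_plus (V := R_NormedModule)); apply coef_sq_summable.
Defined.

Definition H2_scal (l : C) (f : H2) : H2.
Proof.
  exists (fun k => Cmult l (f k)).
  apply (ex_series_ext (fun k => scal (Cmod l ^ 2) (Cmod (f k) ^ 2))).
  - intros n; change (Cmod l ^ 2 * Cmod (f n) ^ 2 = Cmod (Cmult l (f n)) ^ 2).
    rewrite Cmod_mult; ring.
  - apply (ex_series_scal (V := R_NormedModule)); apply coef_sq_summable.
Defined.

Definition H2_opp (f : H2) : H2.
Proof.
  exists (fun k => Copp (f k)).
  apply (ex_series_ext (fun k => Cmod (f k) ^ 2)).
  - intros n; now rewrite Cmod_opp.
  - apply coef_sq_summable.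
Defined.

Definition H2_zero : H2.
Proof.
  exists (fun _ => RtoC 0).
  exists 0; apply (is_series_ext (fun _ => 0)).
  - intros n; change (0 = Cmod (RtoC 0) ^ 2); rewrite Cmod_0; ring.
  - unfold is_series; apply (filterlim_ext (fun _ => 0)).
    + intros n; rewrite sum_n_const; symmetry; apply Rmult_0_r.
    + apply filterlim_const.
Defined.

Lemma H2_sq_ge0 (f : H2) : 0 <= Series (fun k => Cmod (f k) ^ 2).
Proof.
  rewrite <- (Rmult_0_l (Series (fun k => Cmod (f k) ^ 2))), <- Series_scal_l.
  apply Series_le; [|apply coef_sq_summable].
  intros n; pose proof (pow2_ge_0 (Cmod (f n))); lra.
Qed.

Lemma H2_norm_ge0 (f : H2) : 0 <= H2_norm f.
Proof. apply sqrt_pos. Qed.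

Lemma H2_norm_sq (f : H2) : H2_norm f ^ 2 = Series (fun k => Cmod (f k) ^ 2).
Proof. apply pow2_sqrt, H2_sq_ge0. Qed.

Lemma H2_coef_le_norm (f : H2) k : Cmod (f k) <= H2_norm f.
Proof.
  rewrite <- (sqrt_pow2 (Cmod (f k))) by apply Cmod_ge_0.
  apply sqrt_le_1_alt.
  pose proof (coef_sq_summable f) as Hf.
  assert (H : is_series (fun k => Cmod (f k) ^ 2)
                (Series (fun k => Cmod (f k) ^ 2))) by now apply Series_correct.
  apply Rle_trans with (sum_n (fun k => Cmod (f k) ^ 2) k).
  - destruct k as [|k].
    + rewrite sum_O; lra.
    + rewrite sum_Sn.
      assert (0 <= sum_n (fun k => Cmod (f k) ^ 2) k).
      { induction k as [|k IH].
        - rewrite sum_O; apply pow2_ge_0.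
        - rewrite sum_Sn; apply Rplus_le_le_0_compat;
            [exact IH | apply pow2_ge_0]. }
      change plus with Rplus; cbv beta; lra.
  - apply (is_lim_seq_incr_compare _ _ H).
    intros n; rewrite sum_Sn.
    pose proof (pow2_ge_0 (Cmod (f (S n)))).
    change plus with Rplus; lra.
Qed.

Lemma H2_norm_eq0 (f : H2) : H2_norm f = 0 -> f = H2_zero.
Proof.
  intros H; apply H2_ext; intros k; apply Cmod_eq_0.
  pose proof (H2_coef_le_norm f k); pose proof (Cmod_ge_0 (f k)); lra.
Qed.

Lemma H2_norm_le (f g : H2) :
  (forall k, Cmod (f k) <= Cmod (g k)) -> H2_norm f <= H2_norm g.
Proof.
  intros H; apply sqrt_le_1_alt, Series_le; [|apply coef_sq_summable].
  intros k; split; [apply pow2_ge_0|].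
  apply pow_incr; split; [apply Cmod_ge_0 | apply H].
Qed.

Lemma weighted_sq (A B x y : R) : 0 < A -> 0 < B ->
  (x + y) ^ 2 <= (A + B) * (/ A * x ^ 2 + / B * y ^ 2).
Proof.
  intros hA hB.
  assert (E : (A + B) * (/ A * x ^ 2 + / B * y ^ 2) - (x + y) ^ 2
              = (B * x - A * y) ^ 2 * (/ A * / B)) by (field; lra).
  pose proof (pow2_ge_0 (B * x - A * y)).
  assert (0 < / A * / B)
    by (apply Rmult_lt_0_compat; now apply Rinv_0_lt_compat).
  pose proof (Rmult_le_pos _ _ H (Rlt_le _ _ H0)); lra.
Qed.

Lemma H2_norm_triangle (f g : H2) :
  H2_norm (H2_plus f g) <= H2_norm f + H2_norm g.
Proof.
  destruct (Req_dec (H2_norm f) 0) as [Hf|Hf].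
  { rewrite Hf, Rplus_0_l; apply H2_norm_eq0 in Hf; subst f.
    apply H2_norm_le; intros k; simpl; rewrite Cplus_0_l; lra. }
  destruct (Req_dec (H2_norm g) 0) as [Hg|Hg].
  { rewrite Hg, Rplus_0_r; apply H2_norm_eq0 in Hg; subst g.
    apply H2_norm_le; intros k; simpl; rewrite Cplus_0_r; lra. }
  pose proof (H2_norm_ge0 f); pose proof (H2_norm_ge0 g).
  assert (HA : 0 < H2_norm f) by lra.
  assert (HB : 0 < H2_norm g) by lra.
  unfold H2_norm at 1.
  rewrite <- (sqrt_pow2 (H2_norm f + H2_norm g)) by lra.
  apply sqrt_le_1_alt.
  set (A := H2_norm f) in *; set (B := H2_norm g) in *.
  pose proof (coef_sq_summable f) as Sf; pose proof (coef_sq_summable g) as Sg.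
  assert (EA : ex_series (fun k => / A * Cmod (f k) ^ 2))
    by now apply (ex_series_scal (V := R_NormedModule) (/ A)).
  assert (EB : ex_series (fun k => / B * Cmod (g k) ^ 2))
    by now apply (ex_series_scal (V := R_NormedModule) (/ B)).
  apply Rle_trans with (Series (fun k =>
    (A + B) * (/ A * Cmod (f k) ^ 2 + / B * Cmod (g k) ^ 2))).
  - apply Series_le.
    + intros k; split; [apply pow2_ge_0|].
      apply Rle_trans with ((Cmod (f k) + Cmod (g k)) ^ 2).
      * apply pow_incr; split; [apply Cmod_ge_0 | apply Cmod_triangle].
      * now apply weighted_sq.
    + apply (ex_series_scal (V := R_NormedModule) (A + B)).
      now apply (ex_series_plus (V := R_NormedModule)).
  - rewrite Series_scal_l, Series_plus by assumption.
    rewrite !Series_scal_l, <- !H2_norm_sq; fold A B.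
    apply Req_le; field; lra.
Qed.

Lemma H2_norm_scal (l : C) (f : H2) :
  H2_norm (H2_scal l f) <= Cmod l * H2_norm f.
Proof.
  apply Req_le; unfold H2_norm at 1.
  rewrite (Series_ext _ (fun k => Cmod l ^ 2 * Cmod (f k) ^ 2)).
  - rewrite Series_scal_l, sqrt_mult by (apply pow2_ge_0 || apply H2_sq_ge0).
    now rewrite sqrt_pow2 by apply Cmod_ge_0.
  - intros k; simpl coef; rewrite Cmod_mult; ring.
Qed.

Definition H2_AbelianMonoid_mixin : AbelianMonoid.mixin_of H2.
Proof.
  apply (AbelianMonoid.Mixin H2 H2_plus H2_zero);
    intros; apply H2_ext; intros k; simpl; ring.
Defined.

Canonical H2_AbelianMonoid := AbelianMonoid.Pack H2 H2_AbelianMonoid_mixin H2.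

Definition H2_AbelianGroup_mixin : AbelianGroup.mixin_of H2_AbelianMonoid.
Proof.
  apply (AbelianGroup.Mixin H2_AbelianMonoid H2_opp).
  intros; apply H2_ext; intros k; simpl; ring.
Defined.

Canonical H2_AbelianGroup := AbelianGroup.Pack H2
  (AbelianGroup.Class H2 H2_AbelianMonoid_mixin H2_AbelianGroup_mixin) H2.

Definition H2_ModuleSpace_mixin : ModuleSpace.mixin_of C_Ring H2_AbelianGroup.
Proof.
  apply (ModuleSpace.Mixin C_Ring H2_AbelianGroup H2_scal).
  - intros x y u; apply H2_ext; intros k; simpl.
    apply (Cmult_assoc x y (u k)).
  - intros u; apply H2_ext; intros k; simpl; apply (Cmult_1_l (u k)).
  - intros x u v; apply H2_ext; intros k; simpl.
    apply (Cmult_plus_distr_l x (u k) (v k)).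
  - intros x y u; apply H2_ext; intros k; simpl.
    apply (Cmult_plus_distr_r x y (u k)).
Defined.

Canonical H2_ModuleSpace := ModuleSpace.Pack C_Ring H2
  (ModuleSpace.Class C_Ring H2 (AbelianGroup.class H2_AbelianGroup)
     H2_ModuleSpace_mixin) H2.

Definition H2_ball (f : H2) (e : R) (g : H2) : Prop :=
  H2_norm (H2_plus g (H2_opp f)) < e.

Definition H2_UniformSpace_mixin : UniformSpace.mixin_of H2.
Proof.
  apply (UniformSpace.Mixin H2 H2_zero H2_ball); unfold H2_ball.
  - intros x e.
    replace (H2_norm _) with 0; [apply cond_pos|].
    unfold H2_norm.
    rewrite (Series_ext _ (fun _ => 0 * 0)).
    + rewrite Series_scal_l, Rmult_0_l; symmetry; apply sqrt_0.
    + intros k; simpl coef; rewrite Cplus_opp_r, Cmod_0; ring.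
  - intros x y e H; apply Rle_lt_trans with (2 := H).
    apply H2_norm_le; intros k; simpl.
    rewrite <- Cmod_opp; apply Req_le; f_equal; ring.
  - intros x y z e1 e2 H1 H2'.
    replace (H2_plus z (H2_opp x)) with
      (H2_plus (H2_plus z (H2_opp y)) (H2_plus y (H2_opp x))).
    + eapply Rle_lt_trans; [apply H2_norm_triangle | lra].
    + apply H2_ext; intros k; simpl; ring.
Defined.

Canonical H2_UniformSpace := UniformSpace.Pack H2 H2_UniformSpace_mixin H2.

Canonical H2_NormedModuleAux := NormedModuleAux.Pack C_AbsRing H2
  (NormedModuleAux.Class C_AbsRing H2 (ModuleSpace.class _ H2_ModuleSpace)
     H2_UniformSpace_mixin) H2.

Definition H2_NormedModule_mixin :
  NormedModule.mixin_of C_AbsRing H2_NormedModuleAux.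
Proof.
  apply (NormedModule.Mixin C_AbsRing H2_NormedModuleAux H2_norm 1).
  - exact H2_norm_triangle.
  - exact H2_norm_scal.
  - intros x y e H; exact H.
  - intros x y e H; rewrite Rmult_1_l; exact H.
  - exact H2_norm_eq0.
Defined.

Canonical H2_NormedModule := NormedModule.Pack C_AbsRing H2
  (NormedModule.Class C_AbsRing H2 (NormedModuleAux.class _ H2_NormedModuleAux)
     H2_NormedModule_mixin) H2.

(** ** Composition operators *)

(** [T f] and [f o phi] are compared on the half-plane where all elements of
    H^2 are analytic; since coefficients are determined by these values, at most
    one [T] satisfies this for a given [phi]. *)
Definition is_composition_operator (phi : C -> C) (T : H2 -> H2) : Prop :=
  (forall s, halfplane (1/2) s -> halfplane (1/2) (phi s)) /\
  (forall f s, halfplane (1/2) s -> H2_eval (T f) s = H2_eval f (phi s)).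

Definition image_set {A B : Type} (f : A -> B) (D : A -> Prop) : B -> Prop :=
  fun y => exists x, D x /\ y = f x.

(* Main.v *)
(** A compact subset of [Re w > 1/2] lies in a disc [|w - a| <= rho] with
    [rho < R1 < a - 1/2].  For [f] in H^2 the Taylor coefficients at [a] are at most
    [A |f| R1^(-k)], so cutting the Taylor series of [f o phi] in powers of
    [phi - a] after [n - 1] terms leaves an error [O((rho/R1)^n)] that is uniform on
    [Re s > 0].  The powers of [phi - a] and the error are uniform limits of
    Dirichlet polynomials on every half-plane [Re s > eps]; the mean-square identity
    on vertical lines then bounds their H^2 norms by their suprema, so the
    truncation is an operator of rank less than [n] at distance [O((rho/R1)^n)]
    from the composition operator.  Truncating [f] itself at a frequency [M],
    depending on [n] only, keeps every coefficient functional a finite sum. *)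

Require Import Defs.
From Stdlib Require Import Reals Lra Lia Arith List ClassicalChoice.
From Coquelicot Require Import Coquelicot.
Open Scope R_scope.

(** * Finite sums *)

(** Two obstacles shape the argument. First, [T f] is known to agree with f o phi only on Re s >
    1/2, while norm bounds come from suprema over Re s > 0. So the truncation error is treated as a
    function on Re s > 0 in its own right: an element of H^2 with the same values on Re s > 1/2 is
    built from it, and uniqueness there identifies this element with [T f] minus the truncation.
    Second, neither f o phi nor the powers of phi - a come with coefficients. The class
    [approximable] only remembers approximation by polynomials; it is stable under sums, products of
    bounded functions and uniform limits, and [approximable_H2] recovers the coefficients. The
    Taylor remainder is estimated directly, one frequency at a time, from a remainder bound for the
    exponential series, so no Cauchy integral occurs. The frequency cutoff costs d |f| with d free
    and M independent of f; d = r^n with r = rho/R1 preserves the rate. *)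

Fixpoint psum {A : Type} (op : A -> A -> A) (o : A) (u : nat -> A) (n : nat)
  : A :=
  match n with 0%nat => o | S m => op (psum op o u m) (u m) end.

(** Sums over k < n have an empty case and split at m + n without a shift; [sum_n] sums over k <= n,
    so it corresponds to index [S n] here. *)
Notation rsum := (psum Rplus 0).
Notation csum := (psum Cplus (RtoC 0)).
Notation hsum := (psum H2_plus H2_zero).

Lemma psum_S {A : Type} (op : A -> A -> A) (o : A) (u : nat -> A) n :
  psum op o u (S n) = op (psum op o u n) (u n).
Proof. reflexivity. Qed.

Lemma psum_ext {A : Type} (op : A -> A -> A) (o : A) (u v : nat -> A) n :
  (forall k, (k < n)%nat -> u k = v k) -> psum op o u n = psum op o v n.
Proof.
  induction n as [|n IH]; intros H; simpl; [reflexivity|].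
  rewrite IH, H by (intros; try apply H; lia); reflexivity.
Qed.

Lemma csum_sum_n (u : nat -> C) n : sum_n u n = csum u (S n).
Proof.
  induction n as [|n IH].
  - rewrite sum_O; simpl; ring.
  - rewrite sum_Sn, IH; reflexivity.
Qed.

Lemma rsum_sum_n (u : nat -> R) n : sum_n u n = rsum u (S n).
Proof.
  induction n as [|n IH].
  - rewrite sum_O; simpl; ring.
  - rewrite sum_Sn, IH; reflexivity.
Qed.

Lemma rsum_le (u v : nat -> R) n :
  (forall k, (k < n)%nat -> u k <= v k) -> rsum u n <= rsum v n.
Proof.
  induction n as [|n IH]; intros H; simpl; [lra|].
  assert (rsum u n <= rsum v n) by (apply IH; intros; apply H; lia).
  assert (u n <= v n) by (apply H; lia); lra.
Qed.

Lemma rsum_ge0 (u : nat -> R) n : (forall k, 0 <= u k) -> 0 <= rsum u n.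
Proof.
  intros H; induction n as [|n IH]; simpl; [lra|].
  specialize (H n); lra.
Qed.

Lemma rsum_add (u : nat -> R) m n :
  rsum u (m + n) = rsum u m + rsum (fun k => u (m + k)%nat) n.
Proof.
  induction n as [|n IH]; [rewrite Nat.add_0_r; simpl; ring|].
  rewrite Nat.add_succ_r; simpl; rewrite IH; ring.
Qed.

Lemma rsum_mono (u : nat -> R) m n : (forall k, 0 <= u k) -> (m <= n)%nat ->
  rsum u m <= rsum u n.
Proof.
  intros H Hmn; replace n with (m + (n - m))%nat by lia; rewrite rsum_add.
  pose proof (rsum_ge0 (fun k => u (m + k)%nat) (n - m) (fun k => H _)); lra.
Qed.

Lemma rsum_term_le (u : nat -> R) k n : (forall i, 0 <= u i) -> (k < n)%nat ->
  u k <= rsum u n.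
Proof.
  intros H Hk; apply Rle_trans with (rsum u (S k)).
  - simpl; pose proof (rsum_ge0 u k H); lra.
  - apply rsum_mono; [exact H | lia].
Qed.

Lemma rsum_scal (c : R) (u : nat -> R) n :
  rsum (fun k => c * u k) n = c * rsum u n.
Proof. induction n as [|n IH]; simpl; [|rewrite IH]; ring. Qed.

Lemma csum_add (u : nat -> C) m n :
  csum u (m + n) = (csum u m + csum (fun k => u (m + k)%nat) n)%C.
Proof.
  induction n as [|n IH]; [rewrite Nat.add_0_r; simpl; ring|].
  rewrite Nat.add_succ_r; simpl; rewrite IH; ring.
Qed.

Lemma csum_zero n : csum (fun _ => RtoC 0) n = RtoC 0.
Proof. induction n as [|n IH]; simpl; [|rewrite IH]; ring. Qed.

Lemma csum_support (u : nat -> C) m n :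
  (forall k, (m <= k)%nat -> u k = RtoC 0) -> (m <= n)%nat ->
  csum u n = csum u m.
Proof.
  intros H Hmn; replace n with (m + (n - m))%nat by lia; rewrite csum_add.
  rewrite (psum_ext _ _ (fun k => u (m + k)%nat) (fun _ => RtoC 0))
    by (intros; apply H; lia).
  rewrite csum_zero; ring.
Qed.

Lemma csum_scal (c : C) (u : nat -> C) n :
  csum (fun k => (c * u k)%C) n = (c * csum u n)%C.
Proof. induction n as [|n IH]; simpl; [|rewrite IH]; ring. Qed.

Lemma csum_plus (u v : nat -> C) n :
  csum (fun k => (u k + v k)%C) n = (csum u n + csum v n)%C.
Proof. induction n as [|n IH]; simpl; [|rewrite IH]; ring. Qed.

Lemma csum_minus (u v : nat -> C) n :
  csum (fun k => (u k - v k)%C) n = (csum u n - csum v n)%C.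
Proof. induction n as [|n IH]; simpl; [|rewrite IH]; ring. Qed.

Lemma csum_exchange (u : nat -> nat -> C) m n :
  csum (fun i => csum (fun j => u i j) n) m =
  csum (fun j => csum (fun i => u i j) m) n.
Proof.
  induction m as [|m IH]; simpl; [now rewrite csum_zero|].
  rewrite IH, csum_plus; reflexivity.
Qed.

Lemma Cmod_csum_le (u : nat -> C) n :
  Cmod (csum u n) <= rsum (fun k => Cmod (u k)) n.
Proof.
  induction n as [|n IH]; simpl; [rewrite Cmod_0; lra|].
  pose proof (Cmod_triangle (csum u n) (u n)); lra.
Qed.

Lemma Cmod_minus_sym (x y : C) : Cmod (x - y) = Cmod (y - x).
Proof. rewrite <- Cmod_opp; f_equal; ring. Qed.

Lemma Cmod_minus_triangle (x y z : C) :
  Cmod (x - z) <= Cmod (x - y) + Cmod (y - z).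
Proof.
  replace (x - z)%C with ((x - y) + (y - z))%C by ring; apply Cmod_triangle.
Qed.

Lemma Cmod_minus_le (x y : C) : Cmod (x - y) <= Cmod x + Cmod y.
Proof. rewrite <- (Cmod_opp y); apply Cmod_triangle. Qed.

(** Induction with A, B, T the three partial sums: the new cross term satisfies 2Txy <= Ay^2 + Bx^2,
    because T^2 <= AB gives (2Txy)^2 <= 4(Ay^2)(Bx^2) <= (Ay^2 + Bx^2)^2. *)
Lemma cauchy_schwarz (a g : nat -> R) n :
  rsum (fun k => a k * g k) n ^ 2 <=
  rsum (fun k => a k ^ 2) n * rsum (fun k => g k ^ 2) n.
Proof.
  induction n as [|n IH]; [simpl; lra | rewrite !psum_S].
  pose proof (rsum_ge0 (fun k => a k ^ 2) n (fun k => pow2_ge_0 _)) as HA.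
  pose proof (rsum_ge0 (fun k => g k ^ 2) n (fun k => pow2_ge_0 _)) as HB.
  set (A := rsum (fun k => a k ^ 2) n) in *.
  set (B := rsum (fun k => g k ^ 2) n) in *.
  set (T := rsum (fun k => a k * g k) n) in *.
  set (x := a n); set (y := g n).
  assert (H : 2 * T * (x * y) <= A * y ^ 2 + B * x ^ 2).
  { destruct (Rle_dec (2 * T * (x * y)) 0) as [H|H].
    - pose proof (Rmult_le_pos _ _ HA (pow2_ge_0 y)).
      pose proof (Rmult_le_pos _ _ HB (pow2_ge_0 x)); lra.
    - apply Rsqr_incr_0.
      + unfold Rsqr.
        assert (T ^ 2 * (x * y) ^ 2 <= A * B * (x * y) ^ 2)
          by (apply Rmult_le_compat_r; [apply pow2_ge_0 | exact IH]).
        pose proof (pow2_ge_0 (A * y ^ 2 - B * x ^ 2)); nra.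
      + lra.
      + pose proof (Rmult_le_pos _ _ HA (pow2_ge_0 y)).
        pose proof (Rmult_le_pos _ _ HB (pow2_ge_0 x)); lra. }
  replace ((T + x * y) ^ 2) with (T ^ 2 + 2 * T * (x * y) + x ^ 2 * y ^ 2)
    by ring.
  replace ((A + x ^ 2) * (B + y ^ 2))
    with (A * B + (A * y ^ 2 + B * x ^ 2) + x ^ 2 * y ^ 2) by ring.
  lra.
Qed.

Lemma cauchy_schwarz_le (a g : nat -> R) n A G :
  0 <= A -> 0 <= G ->
  rsum (fun k => a k ^ 2) n <= A ^ 2 -> rsum (fun k => g k ^ 2) n <= G ^ 2 ->
  rsum (fun k => a k * g k) n <= A * G.
Proof.
  intros HA HG H1 H2.
  destruct (Rle_dec (rsum (fun k => a k * g k) n) 0) as [H|H].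
  - pose proof (Rmult_le_pos _ _ HA HG); lra.
  - apply Rsqr_incr_0; [|lra|now apply Rmult_le_pos].
    pose proof (cauchy_schwarz a g n) as CS.
    pose proof (rsum_ge0 (fun k => a k ^ 2) n (fun k => pow2_ge_0 _)) as HA'.
    pose proof (rsum_ge0 (fun k => g k ^ 2) n (fun k => pow2_ge_0 _)) as HB'.
    pose proof (Rmult_le_compat _ _ _ _ HA' HB' H1 H2).
    unfold Rsqr; nra.
Qed.

(** * Limits of complex sequences and sums *)

(** Phrased with [Cmod] because the balls of the uniform structure on [C] are squares; the
    non-strict inequality matches the estimates that feed it. *)
Definition Clim (u : nat -> C) (l : C) : Prop :=
  forall d, 0 < d -> exists N, forall n, (N <= n)%nat -> Cmod (u n - l) <= d.

Lemma Clim_parts (u : nat -> C) (l : C) : Clim u l ->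
  is_lim_seq (fun n => Re (u n)) (Re l) /\ is_lim_seq (fun n => Im (u n)) (Im l).
Proof.
  intros H; split; apply is_lim_seq_spec; intros e;
    destruct (H (e / 2)) as [N HN]; try (pose proof (cond_pos e); lra);
    exists N; intros n Hn; specialize (HN n Hn).
  - replace (Re (u n) - Re l) with (Re (u n - l)%C) by reflexivity.
    pose proof (re_le_Cmod (u n - l)%C); pose proof (cond_pos e); lra.
  - replace (Im (u n) - Im l) with (Im (u n - l)%C) by reflexivity.
    pose proof (Rmax_Cmod (u n - l)%C) as HM.
    pose proof (Rmax_r (Rabs (fst (u n - l)%C)) (Rabs (snd (u n - l)%C))).
    unfold Im; pose proof (cond_pos e); lra.
Qed.

Lemma Cmod_le_parts (z : C) : Cmod z <= Rabs (Re z) + Rabs (Im z).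
Proof.
  pose proof (Rabs_pos (Re z)); pose proof (Rabs_pos (Im z)).
  rewrite <- (sqrt_pow2 (Cmod z)) by apply Cmod_ge_0.
  rewrite <- (sqrt_pow2 (Rabs (Re z) + Rabs (Im z))) by lra.
  apply sqrt_le_1_alt; rewrite Cmod2_alt, <- (pow2_abs (Re z)),
    <- (pow2_abs (Im z)); nra.
Qed.

Lemma Clim_of_parts (u : nat -> C) (l : C) :
  is_lim_seq (fun n => Re (u n)) (Re l) ->
  is_lim_seq (fun n => Im (u n)) (Im l) -> Clim u l.
Proof.
  intros H1 H2 d Hd; apply is_lim_seq_spec in H1; apply is_lim_seq_spec in H2.
  assert (Hd2 : 0 < d / 2) by lra.
  destruct (H1 (mkposreal _ Hd2)) as [N1 HN1].
  destruct (H2 (mkposreal _ Hd2)) as [N2 HN2]; simpl in *.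
  exists (max N1 N2); intros n Hn.
  specialize (HN1 n ltac:(lia)); specialize (HN2 n ltac:(lia)).
  apply Rle_trans with (1 := Cmod_le_parts _).
  change (Re (u n - l)%C) with (Re (u n) - Re l).
  change (Im (u n - l)%C) with (Im (u n) - Im l); lra.
Qed.

Lemma Clim_cauchy (u : nat -> C) :
  (forall d, 0 < d -> exists N, forall m n, (N <= m)%nat -> (N <= n)%nat ->
    Cmod (u m - u n) <= d) ->
  exists l, Clim u l.
Proof.
  intros H.
  assert (H1 : ex_finite_lim_seq (fun n => Re (u n))).
  { apply ex_lim_seq_cauchy_corr; intros e.
    destruct (H (e / 2)) as [N HN]; [pose proof (cond_pos e); lra|].
    exists N; intros n m Hn Hm; specialize (HN n m Hn Hm).
    replace (Re (u n) - Re (u m)) with (Re (u n - u m)%C) by reflexivity.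
    pose proof (re_le_Cmod (u n - u m)%C); pose proof (cond_pos e); lra. }
  assert (H2 : ex_finite_lim_seq (fun n => Im (u n))).
  { apply ex_lim_seq_cauchy_corr; intros e.
    destruct (H (e / 2)) as [N HN]; [pose proof (cond_pos e); lra|].
    exists N; intros n m Hn Hm; specialize (HN n m Hn Hm).
    replace (Im (u n) - Im (u m)) with (Im (u n - u m)%C) by reflexivity.
    pose proof (Rmax_Cmod (u n - u m)%C) as HM.
    pose proof (Rmax_r (Rabs (fst (u n - u m)%C)) (Rabs (snd (u n - u m)%C))).
    unfold Im; pose proof (cond_pos e); lra. }
  destruct H1 as [x Hx], H2 as [y Hy].
  exists (x, y); apply Clim_of_parts; assumption.
Qed.

Lemma le_of_eps (x y : R) : (forall d, 0 < d -> x <= y + d) -> x <= y.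
Proof.
  intros H; destruct (Rle_dec x y) as [h|h]; [exact h|].
  specialize (H ((x - y) / 2) ltac:(lra)); lra.
Qed.

Lemma Clim_dist_le (u : nat -> C) (l z : C) B N : Clim u l ->
  (forall n, (N <= n)%nat -> Cmod (u n - z) <= B) -> Cmod (l - z) <= B.
Proof.
  intros Hl H; apply le_of_eps; intros d Hd; destruct (Hl d Hd) as [N' HN].
  specialize (HN (max N N') ltac:(lia)); specialize (H (max N N') ltac:(lia)).
  pose proof (Cmod_minus_triangle l (u (max N N')) z).
  rewrite (Cmod_minus_sym l (u (max N N'))) in H0; lra.
Qed.

Lemma Clim_unique (u : nat -> C) (l l' : C) : Clim u l -> Clim u l' -> l = l'.
Proof.
  intros H H'.
  assert (E : Cmod (l - l') <= 0).
  { apply le_of_eps; intros d Hd; rewrite Rplus_0_l.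
    destruct (H' d Hd) as [N HN]; now apply (Clim_dist_le u l l' d N). }
  assert (E' : Cmod (l - l') = 0) by (pose proof (Cmod_ge_0 (l - l')); lra).
  apply Cmod_eq_0 in E'.
  replace l with ((l - l') + l')%C by ring; rewrite E'; ring.
Qed.

Lemma Clim_ext (u v : nat -> C) l : (forall n, u n = v n) -> Clim u l -> Clim v l.
Proof.
  intros E H d Hd; destruct (H d Hd) as [N HN]; exists N; intros n Hn.
  rewrite <- E; now apply HN.
Qed.

Lemma Clim_plus (u v : nat -> C) l m : Clim u l -> Clim v m ->
  Clim (fun n => (u n + v n)%C) (l + m)%C.
Proof.
  intros Hu Hv d Hd; destruct (Hu (d / 2)) as [N1 H1]; [lra|].
  destruct (Hv (d / 2)) as [N2 H2]; [lra|].
  exists (max N1 N2); intros n Hn.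
  specialize (H1 n ltac:(lia)); specialize (H2 n ltac:(lia)).
  replace (u n + v n - (l + m))%C with ((u n - l) + (v n - m))%C by ring.
  pose proof (Cmod_triangle (u n - l)%C (v n - m)%C); lra.
Qed.

Lemma Clim_scal (c : C) (u : nat -> C) l : Clim u l ->
  Clim (fun n => (c * u n)%C) (c * l)%C.
Proof.
  intros Hu d Hd; pose proof (Cmod_ge_0 c).
  destruct (Hu (d / (Cmod c + 1))) as [N H1]; [apply Rdiv_lt_0_compat; lra|].
  exists N; intros n Hn; specialize (H1 n Hn).
  replace (c * u n - c * l)%C with (c * (u n - l))%C by ring; rewrite Cmod_mult.
  apply Rle_trans with ((Cmod c + 1) * (d / (Cmod c + 1))).
  - apply Rmult_le_compat; try apply Cmod_ge_0; lra.
  - right; field; lra.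
Qed.

Lemma csum_parts (u : nat -> C) n :
  Re (csum u n) = rsum (fun k => Re (u k)) n /\
  Im (csum u n) = rsum (fun k => Im (u k)) n.
Proof.
  induction n as [|n [IH1 IH2]]; [split; reflexivity|].
  simpl psum; rewrite <- IH1, <- IH2; split; reflexivity.
Qed.

Lemma is_series_rsum (u : nat -> R) (l : R) :
  is_series u l <-> is_lim_seq (rsum u) l.
Proof.
  split; intros H.
  - apply is_lim_seq_incr_1; apply (is_lim_seq_ext (sum_n u)).
    + intros n; apply rsum_sum_n.
    + exact H.
  - apply is_lim_seq_incr_1 in H.
    apply (is_lim_seq_ext _ (sum_n u)) in H; [exact H|].
    intros n; symmetry; apply rsum_sum_n.
Qed.

(** Link to [dirichlet], which applies the total function [Series] to real and imaginary parts: only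
    a proof of convergence gives that pair its meaning. *)
Lemma Clim_csum_Series (u : nat -> C) (l : C) : Clim (csum u) l ->
  (Series (fun k => Re (u k)), Series (fun k => Im (u k))) = l.
Proof.
  intros H; apply Clim_parts in H; destruct H as [H1 H2].
  destruct l as [x y]; simpl in *; f_equal; apply is_series_unique,
    is_series_rsum.
  - apply (is_lim_seq_ext _ _ _ (fun n => proj1 (csum_parts u n)) H1).
  - apply (is_lim_seq_ext _ _ _ (fun n => proj2 (csum_parts u n)) H2).
Qed.

Lemma ex_series_bounded (u : nat -> R) B : (forall k, 0 <= u k) ->
  (forall n, rsum u n <= B) -> ex_series u.
Proof.
  intros H0 HB; destruct (ex_finite_lim_seq_incr (rsum u) B) as [l Hl].
  - intros n; simpl; specialize (H0 n); lra.
  - exact HB.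
  - exists l; now apply is_series_rsum.
Qed.

Lemma rsum_le_Series (u : nat -> R) n : (forall k, 0 <= u k) -> ex_series u ->
  rsum u n <= Series u.
Proof.
  intros H0 Hu; apply Series_correct, is_series_rsum in Hu.
  apply (is_lim_seq_incr_compare _ _ Hu); intros k; simpl.
  specialize (H0 k); lra.
Qed.

Lemma Series_le_bound (u : nat -> R) B : ex_series u ->
  (forall n, rsum u n <= B) -> Series u <= B.
Proof.
  intros Hu H; apply Series_correct, is_series_rsum in Hu.
  apply (is_lim_seq_le (rsum u) (fun _ => B) (Series u) B H Hu).
  apply is_lim_seq_const.
Qed.

Lemma Clim_csum_abs (u : nat -> C) B :
  (forall n, rsum (fun k => Cmod (u k)) n <= B) -> exists l, Clim (csum u) l.
Proof.
  intros HB.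
  assert (E : ex_series (fun k => Cmod (u k)))
    by (apply (ex_series_bounded _ B); [intros; apply Cmod_ge_0 | exact HB]).
  apply Clim_cauchy; intros d Hd.
  apply Series_correct, is_series_rsum, is_lim_seq_spec in E.
  assert (Hd2 : 0 < d / 2) by lra.
  destruct (E (mkposreal _ Hd2)) as [N HN]; simpl in HN.
  assert (Hw : forall m n, (N <= m)%nat -> (m <= n)%nat ->
    Cmod (csum u n - csum u m) <= d).
  { intros m n Hm Hn; replace n with (m + (n - m))%nat by lia.
    rewrite csum_add.
    replace (_ - _)%C with (csum (fun k => u (m + k)%nat) (n - m)) by ring.
    apply Rle_trans with (1 := Cmod_csum_le _ _).
    pose proof (HN m Hm) as H1.
    pose proof (HN (m + (n - m))%nat ltac:(lia)) as H2.
    rewrite rsum_add in H2; revert H1 H2; cbv beta.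
    unfold Rabs; repeat destruct Rcase_abs; lra. }
  exists N; intros m n Hm Hn; destruct (Nat.le_ge_cases m n).
  - rewrite Cmod_minus_sym; now apply Hw.
  - now apply Hw.
Qed.

Lemma is_lim_seq_Cmod (u : nat -> C) l z : Clim u l ->
  is_lim_seq (fun n => Cmod (z - u n)) (Cmod (z - l)).
Proof.
  intros H; apply is_lim_seq_spec; intros e.
  destruct (H (e / 2)) as [N HN]; [pose proof (cond_pos e); lra|].
  exists N; intros n Hn; specialize (HN n Hn); pose proof (cond_pos e).
  pose proof (Cmod_minus_triangle z (u n) l).
  pose proof (Cmod_minus_triangle z l (u n)).
  rewrite (Cmod_minus_sym l (u n)) in *.
  unfold Rabs; destruct Rcase_abs; lra.
Qed.

Lemma is_lim_seq_rsum (f : nat -> nat -> R) (g : nat -> R) I :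
  (forall i, is_lim_seq (fun n => f n i) (g i)) ->
  is_lim_seq (fun n => rsum (f n) I) (rsum g I).
Proof.
  intros H; induction I as [|I IH]; simpl; [apply is_lim_seq_const|].
  now apply is_lim_seq_plus'.
Qed.

(** * The complex exponential *)

Lemma Cexp_plus (z w : C) : Cexp (z + w) = (Cexp z * Cexp w)%C.
Proof.
  destruct z as [x y], w as [u v]; unfold Cexp; simpl.
  rewrite exp_plus, cos_plus, sin_plus; unfold Cmult; simpl; f_equal; ring.
Qed.

Lemma Cexp_0 : Cexp 0 = RtoC 1.
Proof.
  unfold Cexp; simpl; rewrite exp_0, cos_0, sin_0; unfold RtoC; f_equal; ring.
Qed.

Lemma Cmod_Cexp (z : C) : Cmod (Cexp z) = exp (Re z).
Proof.
  unfold Cmod, Cexp; simpl fst; simpl snd.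
  replace (_ + _) with (exp (Re z) ^ 2).
  - apply sqrt_pow2, Rlt_le, exp_pos.
  - pose proof (sin2_cos2 (Im z)) as H; unfold Rsqr in H.
    transitivity (exp (Re z) ^ 2 * (sin (Im z) * sin (Im z)
      + cos (Im z) * cos (Im z))); [rewrite H |]; ring.
Qed.

Lemma Cexp_pow (z : C) n : Cexp (RtoC (INR n) * z) = (Cexp z ^ n)%C.
Proof.
  induction n as [|n IH].
  - simpl INR; rewrite Cmult_0_l; apply Cexp_0.
  - rewrite S_INR, Cpow_S, <- IH, <- Cexp_plus; f_equal.
    rewrite RtoC_plus; ring.
Qed.

Lemma exp_le_exp (x y : R) : x <= y -> exp x <= exp y.
Proof.
  intros [H|H]; [now apply Rlt_le, exp_increasing | now rewrite H; right].
Qed.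

Definition exp_term (z : C) (k : nat) : C := (z ^ k * RtoC (/ INR (fact k)))%C.

Lemma exp_term_0 z : exp_term z 0 = RtoC 1.
Proof.
  unfold exp_term; change (INR (fact 0)) with 1; rewrite Rinv_1; apply Cmult_1_r.
Qed.

(** Testing against a multiplier [u] and taking real parts reduces complex derivatives to real ones.
    Differentiation replaces [u] by [u * z], so the family of test functions is closed. *)
Lemma is_derive_Re_Cexp (u z : C) (t : R) :
  is_derive (fun t => Re (u * Cexp (RtoC t * z))) t
    (Re (u * z * Cexp (RtoC t * z))).
Proof.
  destruct u as [a b], z as [x y]; unfold Cexp; simpl.
  auto_derive; [trivial|].
  replace (t * y + 0 * x) with (t * y) by ring.
  replace (t * x - 0 * y) with (t * x) by ring.
  replace (t * x + - (0 * y)) with (t * x) by ring; ring.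
Qed.

Lemma is_derive_exp_term (u z : C) (t : R) k :
  is_derive (fun t => Re (u * exp_term (RtoC t * z) (S k))) t
    (Re (u * z * exp_term (RtoC t * z) k)).
Proof.
  apply (is_derive_ext
    (fun t => t ^ S k * Re (u * exp_term z (S k))%C)).
  { intros s; unfold exp_term; rewrite Cpow_mult_l, <- RtoC_pow.
    rewrite <- re_scal_l; f_equal; ring. }
  replace (Re (u * z * exp_term (RtoC t * z) k))
    with (INR (S k) * t ^ k * Re (u * exp_term z (S k))%C).
  - generalize (Re (u * exp_term z (S k))%C); intros c.
    auto_derive; [trivial|]; rewrite S_INR; destruct k; simpl; ring.
  - unfold exp_term; rewrite <- re_scal_l; f_equal.
    rewrite Cpow_mult_l, <- RtoC_pow, Cpow_S, RtoC_mult.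
    replace (/ INR (fact k)) with (INR (S k) * / INR (fact (S k))).
    + rewrite (RtoC_mult (INR (S k)) (/ INR (fact (S k)))); ring.
    + rewrite fact_simpl, mult_INR; field; split;
        [apply INR_fact_neq_0 | apply not_0_INR; lia].
Qed.

Lemma is_derive_exp_remainder (u z : C) (t : R) n :
  is_derive
    (fun t => Re (u * (Cexp (RtoC t * z) - csum (exp_term (RtoC t * z)) (S n))))
    t (Re (u * z * (Cexp (RtoC t * z) - csum (exp_term (RtoC t * z)) n))).
Proof.
  induction n as [|n IH].
  - simpl psum.
    apply (is_derive_ext (fun t => Re (u * Cexp (RtoC t * z))%C - Re u)).
    { intros s; change (Re (u * Cexp (RtoC s * z)) - Re u)
        with (Re (u * Cexp (RtoC s * z) - u)%C).
      rewrite exp_term_0; f_equal; ring. }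
    replace (Re (u * z * (Cexp (RtoC t * z) - RtoC 0))%C)
      with (Re (u * z * Cexp (RtoC t * z))%C - 0) by (rewrite Rminus_0_r; f_equal; ring).
    apply (is_derive_minus (V := R_NormedModule)).
    + apply is_derive_Re_Cexp.
    + apply (is_derive_const (K := R_AbsRing) (V := R_NormedModule) (Re u)).
  - apply (is_derive_ext (fun t =>
      Re (u * (Cexp (RtoC t * z) - csum (exp_term (RtoC t * z)) (S n)))%C
      - Re (u * exp_term (RtoC t * z) (S n))%C)).
    { intros s; rewrite (psum_S _ _ _ (S n)).
      set (A := csum _ (S n)).
      change (Re (u * (Cexp (RtoC s * z) - A)) - Re (u * exp_term (RtoC s * z) (S n)))
        with (Re (u * (Cexp (RtoC s * z) - A) - u * exp_term (RtoC s * z) (S n))%C).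
      f_equal; ring. }
    rewrite psum_S; set (A := csum _ n) in *.
    replace (Re (u * z * (Cexp (RtoC t * z) - (A + exp_term (RtoC t * z) n)))%C)
      with (Re (u * z * (Cexp (RtoC t * z) - A))%C
        - Re (u * z * exp_term (RtoC t * z) n)%C).
    + apply (is_derive_minus (V := R_NormedModule)); 
        [exact IH | apply is_derive_exp_term].
    + change (Re (u * z * (Cexp (RtoC t * z) - A) - u * z * exp_term (RtoC t * z) n)%C
        = Re (u * z * (Cexp (RtoC t * z) - (A + exp_term (RtoC t * z) n)))).
      f_equal; ring.
Qed.

Lemma le_of_derive_le (f g f' g' : R -> R) :
  (forall t, is_derive f t (f' t)) -> (forall t, is_derive g t (g' t)) ->
  (forall t, 0 <= t -> f' t <= g' t) -> f 0 <= g 0 ->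
  forall t, 0 <= t -> f t <= g t.
Proof.
  intros Hf Hg H H0 t Ht.
  destruct (MVT_gen (fun t => g t - f t) 0 t (fun t => g' t - f' t))
    as [c [Hc E]].
  - intros x _; apply (is_derive_minus (V := R_NormedModule)); [apply Hg | apply Hf].
  - intros x _; apply continuity_pt_filterlim.
    apply (ex_derive_continuous (fun t => g t - f t)).
    exists (minus (g' x) (f' x)).
    apply (is_derive_minus (V := R_NormedModule)); [apply Hg | apply Hf].
  - rewrite Rmin_left in Hc by lra.
    specialize (H c (proj1 Hc)); pose proof (Rmult_le_pos _ _
      (proj1 (Rminus_le_0 _ _) H) Ht); lra.
Qed.

(** The multiplier conj(z)/|z| has modulus 1 and rotates z onto the positive real axis. *)
Lemma Cmod_le_of_Re (z : C) B : 0 <= B ->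
  (forall u, Cmod u <= 1 -> Re (u * z) <= B) -> Cmod z <= B.
Proof.
  intros HB H; destruct (Req_dec (Cmod z) 0) as [E|E]; [lra|].
  pose proof (Cmod_ge_0 z).
  specialize (H (Cconj z * RtoC (/ Cmod z))%C).
  replace (Cmod z) with (Re (Cconj z * RtoC (/ Cmod z) * z)%C).
  - apply H; rewrite Cmod_mult, Cmod_conj, Cmod_R, Rabs_pos_eq.
    + right; field; exact E.
    + apply Rlt_le, Rinv_0_lt_compat; lra.
  - replace (Cconj z * RtoC (/ Cmod z) * z)%C
      with (RtoC (/ Cmod z) * (z * Cconj z))%C by ring.
    rewrite <- Cmod2_conj, re_scal_l, RtoC_pow, <- RtoC_pow, re_RtoC.
    field; exact E.
Qed.

(* The derivative of the remainder of order [n + 1] along a ray is [z] times the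
   remainder of order [n], and the bound integrates in the same way. *)
Lemma Cexp_remainder (q : R) (z : C) n : 1 <= q ->
  Cmod (Cexp z - csum (exp_term z) n) <= (/ q) ^ n * exp (q * Cmod z).
Proof.
  intros Hq.
  assert (Hz : 0 <= Cmod z) by apply Cmod_ge_0.
  assert (Hqn : forall n, 0 < (/ q) ^ n)
    by (intros; apply pow_lt, Rinv_0_lt_compat; lra).
  assert (H : forall t, 0 <= t ->
    Cmod (Cexp (RtoC t * z) - csum (exp_term (RtoC t * z)) n) <=
    (/ q) ^ n * exp (q * (t * Cmod z))).
  { induction n as [|n IH]; intros t Ht.
    - simpl; unfold Cminus; rewrite Rmult_1_l.
      replace (Cexp (t * z) + - 0)%C with (Cexp (t * z)) by ring.
      rewrite Cmod_Cexp, re_scal_l; apply exp_le_exp.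
      pose proof (Rle_abs (Re z)); pose proof (re_le_Cmod z).
      assert (t * Re z <= t * Cmod z) by (apply Rmult_le_compat_l; lra).
      assert (0 <= t * Cmod z) by (now apply Rmult_le_pos).
      assert (1 * (t * Cmod z) <= q * (t * Cmod z))
        by (apply Rmult_le_compat_r; lra); lra.
    - apply Cmod_le_of_Re.
      { apply Rlt_le, Rmult_lt_0_compat; [apply Hqn | apply exp_pos]. }
      intros u Hu; revert t Ht.
      (* Differentiating q^(-(n+1)) e^(qt|z|) in t releases a factor q|z|; q cancels one inverse
         power, leaving exactly |z| times the bound of order n. *)
      apply (le_of_derive_le _ _
        (fun t => Re (u * z * (Cexp (RtoC t * z) - csum (exp_term (RtoC t * z)) n)))
        (fun t => Cmod z * ((/ q) ^ n * exp (q * (t * Cmod z))))).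
      + intros t; apply is_derive_exp_remainder.
      + intros t; auto_derive; [trivial|]; field; lra.
      + intros t Ht; eapply Rle_trans; [apply Rle_abs|].
        eapply Rle_trans; [apply re_le_Cmod|]; rewrite !Cmod_mult.
        apply Rmult_le_compat; try apply Cmod_ge_0;
          [apply Rmult_le_pos; apply Cmod_ge_0| |now apply IH].
        rewrite <- (Rmult_1_l (Cmod z)) at 2.
        now apply Rmult_le_compat_r.
      (* At t = 0 only the term k = 0 of the exponential series survives, so the remainder of order
         [S n] vanishes. *)
      + replace (Re _) with 0.
        * apply Rlt_le, Rmult_lt_0_compat; [apply Hqn | apply exp_pos].
        * rewrite Cmult_0_l, Cexp_0.
          replace (csum (exp_term 0) (S n)) with (RtoC 1).
          { replace (u * (1 - 1))%C with (RtoC 0) by ring; reflexivity. }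
          clear; induction n as [|n IH].
          { rewrite psum_S, exp_term_0; simpl; ring. }
          rewrite psum_S, <- IH; unfold exp_term; simpl Cpow; ring. }
  specialize (H 1 ltac:(lra)); now rewrite Cmult_1_l, Rmult_1_l in H.
Qed.

(** * Mean squares of exponential sums *)

Lemma Cpow_unit (w : C) n : Cmod w = 1 -> Cmod (w ^ n) = 1.
Proof. intros H; rewrite Cmod_pow, H; apply pow1. Qed.

Lemma csum_geom (w : C) n :
  ((1 - w) * csum (fun j => (w ^ j)%C) n = 1 - w ^ n)%C.
Proof.
  induction n as [|n IH]; simpl; [ring|].
  rewrite Cmult_plus_distr_l, IH; ring.
Qed.

(** For each frequency the sum over j is geometric, of modulus at most 2/|1 - w k|; this is finite
    because w k is not 1, and it does not depend on n. *)
Lemma exp_sum_bounded (b w : nat -> C) N :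
  (forall k, (k < N)%nat -> Cmod (w k) = 1 /\ w k <> RtoC 1) ->
  exists M, forall n,
    Cmod (csum (fun j => csum (fun k => (b k * w k ^ j)%C) N) n) <= M.
Proof.
  induction N as [|N IH]; intros H.
  - exists 0; intros n; simpl; rewrite csum_zero, Cmod_0; lra.
  - destruct IH as [M HM]; [intros; apply H; lia|].
    destruct (H N ltac:(lia)) as [H1 H2].
    assert (Hw : 0 < Cmod (1 - w N)).
    { apply Cmod_gt_0; intros E; apply H2.
      replace (w N) with (1 - (1 - w N))%C by ring; rewrite E; ring. }
    exists (M + Cmod (b N) * (2 / Cmod (1 - w N))); intros n.
    rewrite (psum_ext _ _ _ (fun j => csum (fun k => (b k * w k ^ j)%C) N
      + b N * w N ^ j)%C) by reflexivity.
    rewrite csum_plus, csum_scal.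
    eapply Rle_trans; [apply Cmod_triangle|].
    apply Rplus_le_compat; [apply HM|].
    rewrite Cmod_mult; apply Rmult_le_compat_l; [apply Cmod_ge_0|].
    apply Rmult_le_reg_l with (1 := Hw).
    rewrite <- Cmod_mult, csum_geom.
    eapply Rle_trans; [apply Cmod_minus_le|].
    rewrite Cpow_unit, Cmod_1 by exact H1; right; field; lra.
Qed.

Lemma Cmod_plus_sq (x y : C) :
  Cmod (x + y) ^ 2 = Cmod x ^ 2 + Cmod y ^ 2 + 2 * Re (x * Cconj y)%C.
Proof.
  rewrite !Cmod2_alt; destruct x, y; simpl; ring.
Qed.

(** Approximate orthogonality of distinct characters, by induction on the number of frequencies.
    Summed over j, the cross terms with the new frequency form an exponential sum in z k conj(z N),
    which is not 1; hence they stay bounded, and the defect M does not depend on n. *)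
Lemma exp_sum_mean_square (b z : nat -> C) N :
  (forall k, Cmod (z k) = 1) ->
  (forall k l, (k < l < N)%nat -> z k <> z l) ->
  exists M, forall n,
    INR n * rsum (fun k => Cmod (b k) ^ 2) N - M <=
    rsum (fun j => Cmod (csum (fun k => (b k * z k ^ j)%C) N) ^ 2) n.
Proof.
  intros Hz; induction N as [|N IH]; intros H.
  - exists 0; intros n; rewrite Rminus_0_r.
    replace (INR n * _) with 0 by (simpl; ring).
    apply rsum_ge0; intros k; apply pow2_ge_0.
  - destruct IH as [M HM]; [intros; apply H; lia|].
    destruct (exp_sum_bounded b (fun k => z k * Cconj (z N))%C N) as [M' HM'].
    { intros k Hk; split.
      - rewrite Cmod_mult, Cmod_conj, !Hz; ring.
      - intros E; apply (H k N ltac:(lia)).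
        transitivity (z k * Cconj (z N) * z N)%C; [|rewrite E; ring].
        transitivity (z k * (z N * Cconj (z N)))%C; [|ring].
        rewrite <- Cmod2_conj, Hz, pow1; ring. }
    exists (M + 2 * (Cmod (b N) * M')); intros n.
    set (F j := csum (fun k => (b k * z k ^ j)%C) N) in *.
    assert (E : rsum (fun j => Cmod (F j + b N * z N ^ j) ^ 2) n =
      rsum (fun j => Cmod (F j) ^ 2) n + INR n * Cmod (b N) ^ 2 +
      2 * Re (Cconj (b N) * csum (fun j =>
        csum (fun k => (b k * (z k * Cconj (z N)) ^ j)%C) N) n)%C).
    { clear HM HM'; induction n as [|n IH]; [simpl; ring|].
      rewrite !psum_S, IH, Cmod_plus_sq, S_INR, Cmod_mult, Cpow_unit by apply Hz.
      rewrite Cmult_plus_distr_l, re_plus.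
      replace (csum (fun k => (b k * (z k * Cconj (z N)) ^ n)%C) N)
        with (F n * Cconj (z N ^ n))%C.
      - rewrite Cmult_conj.
        replace (Cconj (b N) * (F n * Cconj (z N ^ n)))%C
          with (F n * (Cconj (b N) * Cconj (z N ^ n)))%C by ring.
        ring.
      - unfold F; rewrite Cmult_comm, <- csum_scal; apply psum_ext; intros k _.
        rewrite Cpow_mult_l, Cpow_conj; ring. }
    change (INR n * rsum (fun k => Cmod (b k) ^ 2) (S N) - (M + 2 * (Cmod (b N) * M'))
      <= rsum (fun j => Cmod (F j + b N * z N ^ j) ^ 2) n).
    rewrite E, psum_S; specialize (HM n); specialize (HM' n).
    change (INR n * rsum (fun k => Cmod (b k) ^ 2) N - M <=
      rsum (fun j => Cmod (F j) ^ 2) n) in HM.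
    set (X := csum _ n) in *.
    pose proof (re_le_Cmod (Cconj (b N) * X)%C) as HR.
    rewrite Cmod_mult, Cmod_conj in HR.
    pose proof (Rmult_le_compat_l _ _ _ (Cmod_ge_0 (b N)) HM').
    pose proof (Rle_abs (- Re (Cconj (b N) * X)%C)); rewrite Rabs_Ropp in *.
    rewrite Rmult_plus_distr_l; lra.
Qed.

(** Dividing by n and letting n grow removes the defect M; this takes the place of a limit of
    means. *)
Lemma le_of_INR_mult_le (x y M : R) :
  (forall n, INR n * x - M <= INR n * y) -> x <= y.
Proof.
  intros H; destruct (Rle_dec x y) as [h|h]; [exact h|].
  destruct (nfloor_ex (Rabs M / (x - y))) as [n [_ Hn]].
  { apply Rmult_le_pos; [apply Rabs_pos|].
    apply Rlt_le, Rinv_0_lt_compat; lra. }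
  specialize (H (S n)); rewrite S_INR in H.
  apply (Rmult_lt_compat_r (x - y)) in Hn; [|lra].
  replace (Rabs M / (x - y) * (x - y)) with (Rabs M) in Hn by (field; lra).
  pose proof (Rle_abs M); lra.
Qed.

Lemma exp_sum_bound (b z : nat -> C) N B :
  (forall k, Cmod (z k) = 1) ->
  (forall k l, (k < l < N)%nat -> z k <> z l) ->
  (forall j, Cmod (csum (fun k => (b k * z k ^ j)%C) N) <= B) ->
  rsum (fun k => Cmod (b k) ^ 2) N <= B ^ 2.
Proof.
  intros Hz Hd HB; destruct (exp_sum_mean_square b z N Hz Hd) as [M HM].
  apply (le_of_INR_mult_le _ _ M); intros n.
  apply Rle_trans with (1 := HM n).
  clear HM; induction n as [|n IH]; [simpl; lra|].
  rewrite psum_S, S_INR.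
  assert (Cmod (csum (fun k => (b k * z k ^ n)%C) N) ^ 2 <= B ^ 2)
    by (apply pow_incr; split; [apply Cmod_ge_0 | apply HB]).
  lra.
Qed.

(** With h = (x - y)/2, the hypotheses give cos 2h = 1, so sin h = 0, and |h| < pi leaves only h =
    0. *)
Lemma cos_sin_inj (x y : R) : Rabs (x - y) < 2 * PI ->
  cos x = cos y -> sin x = sin y -> x = y.
Proof.
  intros H Hc Hs; set (h := (x - y) / 2).
  assert (E : cos (2 * h) = 1).
  { replace (2 * h) with (x - y) by (unfold h; field).
    rewrite cos_minus, Hc, Hs; pose proof (sin2_cos2 y); unfold Rsqr in *; lra. }
  rewrite cos_2a_sin in E.
  assert (E' : sin h = 0) by (apply Rsqr_0_uniq; unfold Rsqr; lra).
  assert (Hh : Rabs h < PI).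
  { unfold h; rewrite Rabs_div by lra; rewrite (Rabs_pos_eq 2) by lra; lra. }
  apply Rabs_def2 in Hh.
  destruct (Rtotal_order h 0) as [Hlt|[Heq|Hgt]].
  - pose proof (sin_lt_0_var h); lra.
  - unfold h in Heq; lra.
  - pose proof (sin_gt_0 h); lra.
Qed.

(** * Logarithmic frequencies and Dirichlet polynomials on vertical lines *)

Definition freq (k : nat) : R := ln (INR (S k)).

Lemma freq_ge0 k : 0 <= freq k.
Proof.
  unfold freq; rewrite <- ln_1; apply ln_le; [lra|].
  change 1 with (INR 1); apply le_INR; lia.
Qed.

Lemma freq_lt k l : (k < l)%nat -> freq k < freq l.
Proof.
  intros H; apply ln_increasing; [apply lt_0_INR; lia | apply lt_INR; lia].
Qed.

Lemma dirichlet_termE b s k :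
  dirichlet_term b s k = (b k * Cexp (- s * RtoC (freq k)))%C.
Proof. reflexivity. Qed.

Lemma Cmod_dirichlet_term b s k :
  Cmod (dirichlet_term b s k) = Cmod (b k) * exp (- Re s * freq k).
Proof.
  rewrite dirichlet_termE, Cmod_mult, Cmod_Cexp; do 2 f_equal.
  destruct s; simpl; ring.
Qed.

(* Sampling at the imaginary parts [j / (1 + freq N)] already separates the
   frequencies, so that no integral over the vertical line is needed. *)
Lemma dirichlet_mean_square (b : nat -> C) N sigma B :
  (forall s, Re s = sigma -> Cmod (csum (dirichlet_term b s) N) <= B) ->
  rsum (fun k => Cmod (b k) ^ 2 * exp (- (2 * sigma) * freq k)) N <= B ^ 2.
Proof.
  intros H; pose proof (freq_ge0 N) as HN; set (tau := / (1 + freq N)).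
  assert (Ht : 0 < tau) by (apply Rinv_0_lt_compat; lra).
  (* At the sample s = sigma + i tau j the k-th term is [a k * z k ^ j]: the modulus goes into [a],
     the rotation into [z]. *)
  set (a k := (b k * RtoC (exp (- sigma * freq k)))%C).
  set (z k := Cexp (0, - tau * freq k)).
  rewrite (psum_ext _ _ _ (fun k => Cmod (a k) ^ 2)).
  - apply (exp_sum_bound a z N B).
    + intros k; unfold z; rewrite Cmod_Cexp; simpl; apply exp_0.
    + intros k l [Hkl HlN] E; unfold z, Cexp in E; simpl in E.
      rewrite exp_0, !Rmult_1_l in E; injection E as E1 E2.
      pose proof (freq_lt _ _ Hkl); pose proof (freq_lt _ _ HlN).
      pose proof (freq_ge0 k).
      apply cos_sin_inj in E2; [|clear E2|exact E1].
      * nra.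
      * replace (- tau * freq k - - tau * freq l)
          with (tau * (freq l - freq k)) by ring.
        rewrite Rabs_pos_eq by nra.
        apply Rle_lt_trans with 1; [|pose proof PI2_1; lra].
        apply Rmult_le_reg_l with (1 + freq N); [lra|].
        unfold tau; rewrite <- Rmult_assoc, Rinv_r by lra; lra.
    + intros j; specialize (H (sigma, tau * INR j) eq_refl).
      rewrite (psum_ext _ _ _ (dirichlet_term b (sigma, tau * INR j))); [exact H|].
      intros k _; unfold a, z; rewrite dirichlet_termE, <- Cexp_pow.
      rewrite <- Cmult_assoc; f_equal.
      transitivity (Cexp (RtoC (- sigma * freq k)) *
        Cexp (RtoC (INR j) * (0, - tau * freq k)%R))%C.
      * f_equal; unfold Cexp, RtoC; simpl; rewrite cos_0, sin_0; f_equal; ring.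
      * rewrite <- Cexp_plus; f_equal; unfold RtoC, Cmult, Cplus, Copp; simpl;
          f_equal; ring.
  - intros k _; unfold a; rewrite Cmod_mult, Cmod_R.
    rewrite (Rabs_pos_eq (exp _)) by (apply Rlt_le, exp_pos).
    rewrite Rpow_mult_distr; f_equal; simpl; rewrite Rmult_1_r, <- exp_plus.
    f_equal; ring.
Qed.

(** * Elements of H^2 and their values *)

Lemma exp_freq k : exp (freq k) = INR (S k).
Proof. apply exp_ln, lt_0_INR; lia. Qed.

Lemma exp_ge_1_plus (x : R) : 1 + x <= exp x.
Proof.
  destruct (Req_dec x 0) as [E|E].
  - subst; rewrite exp_0; lra.
  - apply Rlt_le, exp_ineq1; exact E.
Qed.

(** This is 1/(n+2) <= ln((n+2)/(n+1)), obtained from 1 + x <= e^x at x = [freq n - freq (S n)]. It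
    plays the part of an integral comparison in [zeta_bound]. *)
Lemma freq_step n : exp (- freq (S n)) <= freq (S n) - freq n.
Proof.
  pose proof (exp_ge_1_plus (freq n - freq (S n))) as H.
  unfold Rminus in H at 2.
  rewrite exp_plus, exp_Ropp, !exp_freq in H; rewrite exp_Ropp, exp_freq.
  assert (0 < INR (S (S n))) by (apply lt_0_INR; lia).
  replace (INR (S n) * / INR (S (S n))) with (1 - / INR (S (S n))) in H.
  - lra.
  - rewrite (S_INR (S n)) in *; field; lra.
Qed.

Lemma zeta_bound (x : R) n : 0 < x ->
  rsum (fun k => exp (- (1 + x) * freq k)) n <= 1 + / x.
Proof.
  intros Hx; assert (Hx' : 0 < / x) by now apply Rinv_0_lt_compat.
  destruct n as [|n]; [simpl; lra|].
  (* The bound is sharpened to 1 plus the integral of t^(-1-x) from 1 to n + 1, so that the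
     induction telescopes. *)
  apply Rle_trans with (1 + / x * (1 - exp (- x * freq n))).
  - induction n as [|n IH].
    + simpl; unfold freq; simpl; rewrite ln_1, !Rmult_0_r, exp_0; lra.
    + rewrite psum_S.
      enough (exp (- (1 + x) * freq (S n)) <=
        / x * (exp (- x * freq n) - exp (- x * freq (S n)))) by lra.
      apply Rmult_le_reg_l with (1 := Hx).
      rewrite <- Rmult_assoc, Rinv_r, Rmult_1_l by lra.
      replace (exp (- (1 + x) * freq (S n)))
        with (exp (- freq (S n)) * exp (- x * freq (S n)))
        by (rewrite <- exp_plus; f_equal; ring).
      replace (exp (- x * freq n))
        with (exp (x * (freq (S n) - freq n)) * exp (- x * freq (S n)))
        by (rewrite <- exp_plus; f_equal; ring).
      pose proof (exp_pos (- x * freq (S n))).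
      pose proof (exp_ge_1_plus (x * (freq (S n) - freq n))).
      pose proof (Rmult_le_compat_l x _ _ (Rlt_le _ _ Hx) (freq_step n)).
      rewrite <- Rmult_assoc.
      replace (exp (x * (freq (S n) - freq n)) * exp (- x * freq (S n)) -
        exp (- x * freq (S n)))
        with ((exp (x * (freq (S n) - freq n)) - 1) * exp (- x * freq (S n)))
        by ring.
      apply Rmult_le_compat_r; lra.
  - pose proof (Rmult_lt_0_compat _ _ Hx' (exp_pos (- x * freq n))); lra.
Qed.

Lemma rsum_tail (u : nat -> R) B : (forall k, 0 <= u k) ->
  (forall n, rsum u n <= B) -> forall d, 0 < d ->
  exists M, forall m n, (M <= m)%nat -> rsum (fun k => u (m + k)%nat) n <= d.
Proof.
  intros H0 HB d Hd; pose proof (ex_series_bounded u B H0 HB) as E.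
  pose proof E as E'; apply Series_correct, is_series_rsum, is_lim_seq_spec in E'.
  destruct (E' (mkposreal d Hd)) as [M HM]; simpl in HM.
  exists M; intros m n Hm; specialize (HM m Hm).
  pose proof (rsum_le_Series u (m + n) H0 E) as H; rewrite rsum_add in H.
  apply Rabs_def2 in HM; lra.
Qed.

Lemma zeta_tail (theta d : R) : 1 / 2 < theta -> 0 < d ->
  exists M, forall m n, (M <= m)%nat ->
    rsum (fun k => exp (- theta * freq (m + k)) ^ 2) n <= d ^ 2.
Proof.
  intros Ht Hd.
  apply (rsum_tail (fun k => exp (- theta * freq k) ^ 2) (1 + / (2 * theta - 1))).
  - intros; apply pow2_ge_0.
  - intros n; rewrite (psum_ext _ _ _
      (fun k => exp (- (1 + (2 * theta - 1)) * freq k))).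
    + apply zeta_bound; lra.
    + intros k _; simpl; rewrite Rmult_1_r, <- exp_plus; f_equal; ring.
  - now apply pow_lt.
Qed.

Lemma H2_rsum_le (f : H2) n : rsum (fun k => Cmod (f k) ^ 2) n <= H2_norm f ^ 2.
Proof.
  rewrite H2_norm_sq; apply rsum_le_Series;
    [intros; apply pow2_ge_0 | apply coef_sq_summable].
Qed.

Lemma H2_block_le (f : H2) m n (g : nat -> R) G : 0 <= G ->
  (forall k, 0 <= g k) -> rsum (fun k => g k ^ 2) n <= G ^ 2 ->
  rsum (fun k => Cmod (f (m + k)%nat) * g k) n <= H2_norm f * G.
Proof.
  intros HG Hg H; apply cauchy_schwarz_le; [apply H2_norm_ge0|exact HG| |exact H].
  pose proof (H2_rsum_le f (m + n)) as Hf; rewrite rsum_add in Hf.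
  pose proof (rsum_ge0 (fun k => Cmod (f k) ^ 2) m (fun k => pow2_ge_0 _)); lra.
Qed.

(** The offset m serves two purposes: m = 0 yields absolute convergence, a large m yields tail
    bounds uniform in s. *)
Lemma dirichlet_block_le (f : H2) theta s m n d : 0 <= d -> theta <= Re s ->
  rsum (fun k => exp (- theta * freq (m + k)) ^ 2) n <= d ^ 2 ->
  rsum (fun k => Cmod (dirichlet_term f s (m + k))) n <= H2_norm f * d.
Proof.
  intros Hd Hs H.
  eapply Rle_trans;
    [|apply (H2_block_le f m n _ d Hd (fun k => Rlt_le _ _ (exp_pos _)) H)].
  apply rsum_le; intros k _; rewrite Cmod_dirichlet_term.
  apply Rmult_le_compat_l; [apply Cmod_ge_0|]; apply exp_le_exp.
  apply Rmult_le_compat_r; [apply freq_ge0 | lra].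
Qed.

Lemma H2_eval_Clim (f : H2) s : 1 / 2 < Re s ->
  Clim (csum (dirichlet_term f s)) (H2_eval f s).
Proof.
  intros Hs.
  destruct (Clim_csum_abs (dirichlet_term f s)
    (H2_norm f * sqrt (1 + / (2 * Re s - 1)))) as [l Hl].
  - intros n; apply (dirichlet_block_le f (Re s) s 0 n);
      [apply sqrt_pos | lra |].
    assert (0 < / (2 * Re s - 1)) by (apply Rinv_0_lt_compat; lra).
    rewrite pow2_sqrt by lra.
    rewrite (psum_ext _ _ _
      (fun k => exp (- (1 + (2 * Re s - 1)) * freq k))).
    + apply zeta_bound; lra.
    + intros k _; simpl; rewrite Rmult_1_r, <- exp_plus; f_equal; ring.
  - unfold H2_eval, dirichlet; now rewrite (Clim_csum_Series _ _ Hl).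
Qed.

(** The cutoff M is chosen before f and s. This uniformity is what allows a single truncation to
    define an operator. *)
Lemma H2_eval_tail (theta d : R) : 1 / 2 < theta -> 0 < d ->
  exists M, forall (f : H2) s n, theta <= Re s -> (M <= n)%nat ->
    Cmod (H2_eval f s - csum (dirichlet_term f s) n) <= H2_norm f * d.
Proof.
  intros Ht Hd; destruct (zeta_tail theta d Ht Hd) as [M HM].
  exists M; intros f s n Hs Hn.
  apply (Clim_dist_le _ _ _ _ n (H2_eval_Clim f s ltac:(lra))); intros m Hm.
  replace m with (n + (m - n))%nat by lia; rewrite csum_add.
  replace (_ - _)%C with (csum (fun k => dirichlet_term f s (n + k)) (m - n))
    by ring.
  eapply Rle_trans; [apply Cmod_csum_le|].
  apply (dirichlet_block_le f theta s n); [lra | exact Hs | now apply HM].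
Qed.

Lemma dirichlet_term_plus (a b : nat -> C) s k :
  dirichlet_term (fun k => (a k + b k)%C) s k =
  (dirichlet_term a s k + dirichlet_term b s k)%C.
Proof. unfold dirichlet_term; ring. Qed.

Lemma dirichlet_term_scal (c : C) (a : nat -> C) s k :
  dirichlet_term (fun k => (c * a k)%C) s k = (c * dirichlet_term a s k)%C.
Proof. unfold dirichlet_term; ring. Qed.

Lemma csum_dirichlet_minus (a b : nat -> C) s n :
  csum (dirichlet_term (fun k => (a k - b k)%C) s) n =
  (csum (dirichlet_term a s) n - csum (dirichlet_term b s) n)%C.
Proof.
  rewrite <- csum_minus; apply psum_ext; intros; unfold dirichlet_term; ring.
Qed.

Lemma H2_eval_plus (f g : H2) s : 1 / 2 < Re s ->
  H2_eval (H2_plus f g) s = (H2_eval f s + H2_eval g s)%C.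
Proof.
  intros Hs; apply (Clim_unique (csum (dirichlet_term (H2_plus f g) s)));
    [now apply H2_eval_Clim|].
  apply (Clim_ext (fun n =>
    csum (dirichlet_term f s) n + csum (dirichlet_term g s) n)%C).
  - intros n; rewrite <- csum_plus; apply psum_ext; intros k _.
    symmetry; apply dirichlet_term_plus.
  - apply Clim_plus; now apply H2_eval_Clim.
Qed.

Lemma H2_eval_scal (c : C) (f : H2) s : 1 / 2 < Re s ->
  H2_eval (H2_scal c f) s = (c * H2_eval f s)%C.
Proof.
  intros Hs; apply (Clim_unique (csum (dirichlet_term (H2_scal c f) s)));
    [now apply H2_eval_Clim|].
  apply (Clim_ext (fun n => c * csum (dirichlet_term f s) n)%C).
  - intros n; rewrite <- csum_scal; apply psum_ext; intros k _.
    symmetry; apply dirichlet_term_scal.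
  - apply Clim_scal; now apply H2_eval_Clim.
Qed.

Lemma H2_eval_zero s : 1 / 2 < Re s -> H2_eval H2_zero s = RtoC 0.
Proof.
  intros Hs; replace H2_zero with (H2_scal 0 H2_zero).
  - rewrite H2_eval_scal by exact Hs; ring.
  - apply H2_ext; intros k; simpl; ring.
Qed.

Lemma H2_eval_hsum (v : nat -> H2) s n : 1 / 2 < Re s ->
  H2_eval (hsum v n) s = csum (fun k => H2_eval (v k) s) n.
Proof.
  intros Hs; induction n as [|n IH]; simpl; [now apply H2_eval_zero|].
  now rewrite H2_eval_plus, IH.
Qed.

Lemma le_of_weighted_sq_le (a c sigma f : R) : 0 <= a -> 0 <= c ->
  a ^ 2 * exp (- (2 * sigma) * f) <= c ^ 2 -> a <= c * exp (sigma * f).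
Proof.
  intros Ha Hc H; pose proof (exp_pos (sigma * f)).
  apply Rsqr_incr_0; [|exact Ha | now apply Rmult_le_pos; [|apply Rlt_le]].
  unfold Rsqr.
  replace (c * exp (sigma * f) * (c * exp (sigma * f)))
    with (c ^ 2 * exp (2 * sigma * f)).
  - replace (a * a) with (a ^ 2 * exp (- (2 * sigma) * f) * exp (2 * sigma * f)).
    + apply Rmult_le_compat_r; [apply Rlt_le, exp_pos | exact H].
    + rewrite Rmult_assoc, <- exp_plus.
      replace (- (2 * sigma) * f + 2 * sigma * f) with 0 by ring.
      rewrite exp_0; ring.
  - replace (2 * sigma * f) with (sigma * f + sigma * f) by ring.
    rewrite exp_plus; ring.
Qed.

(** On the line Re s = 2 the partial sums of f - g are uniformly small, since f and g have equal
    values there and uniformly small tails. The mean-square inequality turns this into smallness of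
    each coefficient, at the price of a factor (k+1)^2. *)
Lemma H2_eval_inj (f g : H2) :
  (forall s, 1 / 2 < Re s -> H2_eval f s = H2_eval g s) -> f = g.
Proof.
  intros H; apply H2_ext; intros k.
  set (A := H2_norm f + H2_norm g).
  assert (HA : 0 <= A)
    by (pose proof (H2_norm_ge0 f); pose proof (H2_norm_ge0 g); unfold A; lra).
  assert (E : Cmod (f k - g k) <= 0).
  { apply le_of_eps; intros d Hd; rewrite Rplus_0_l.
    pose proof (exp_pos (2 * freq k)) as He.
    (* The 1 in A + 1 only guards against division by zero when both norms vanish. *)
    set (d' := d / ((A + 1) * exp (2 * freq k))).
    assert (HA1 : 0 < (A + 1) * exp (2 * freq k))
      by (apply Rmult_lt_0_compat; lra).
    assert (Hd' : 0 < d') by now apply Rdiv_lt_0_compat.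
    destruct (H2_eval_tail 2 d' ltac:(lra) Hd') as [M HM].
    apply Rle_trans with (A * d' * exp (2 * freq k)).
    - apply le_of_weighted_sq_le; [apply Cmod_ge_0 | |].
      { apply Rmult_le_pos; lra. }
      eapply Rle_trans; [|apply (dirichlet_mean_square
        (fun k => (f k - g k)%C) (max M (S k)) 2 (A * d'))].
      + apply (rsum_term_le
          (fun k => Cmod (f k - g k) ^ 2 * exp (- (2 * 2) * freq k))); [|lia].
        intros i; apply Rmult_le_pos; [apply pow2_ge_0 | apply Rlt_le, exp_pos].
      + intros s Hs; rewrite csum_dirichlet_minus.
        pose proof (HM f s (max M (S k)) ltac:(lra) ltac:(lia)) as Hf.
        pose proof (HM g s (max M (S k)) ltac:(lra) ltac:(lia)) as Hg.
        rewrite <- (H s) in Hg by lra.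
        rewrite Cmod_minus_sym in Hf.
        eapply Rle_trans; [apply (Cmod_minus_triangle _ (H2_eval f s))|].
        unfold A; lra.
    - apply Rle_trans with ((A + 1) * d' * exp (2 * freq k)).
      + repeat apply Rmult_le_compat_r; lra.
      + right; unfold d'; field; lra. }
  assert (E' : Cmod (f k - g k) = 0) by (pose proof (Cmod_ge_0 (f k - g k)); lra).
  apply Cmod_eq_0 in E'.
  replace (f k : C) with ((f k - g k) + g k)%C by ring; rewrite E'; ring.
Qed.

(** * Functions approximable by Dirichlet polynomials *)

Definition dirichlet_poly (F : C -> C) : Prop :=
  exists b N, forall s, F s = csum (dirichlet_term b s) N.

(** In [dirichlet_poly] the coefficients from index N on are arbitrary. Setting them to zero allows
    polynomials of different lengths to be summed to a common length. *)
Lemma dirichlet_poly_support (F : C -> C) : dirichlet_poly F ->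
  exists b N, (forall k, (N <= k)%nat -> b k = RtoC 0) /\
    forall s, F s = csum (dirichlet_term b s) N.
Proof.
  intros [b [N H]].
  exists (fun k => if (k <? N)%nat then b k else RtoC 0), N; split.
  - intros k Hk; now rewrite (proj2 (Nat.ltb_ge _ _) Hk).
  - intros s; rewrite H; apply psum_ext; intros k Hk; unfold dirichlet_term.
    now rewrite (proj2 (Nat.ltb_lt _ _) Hk).
Qed.

Lemma dirichlet_term_0 b s k : b k = RtoC 0 -> dirichlet_term b s k = RtoC 0.
Proof. intros E; unfold dirichlet_term; rewrite E; ring. Qed.

Lemma dirichlet_poly_monomial (z : C) k :
  dirichlet_poly (fun s => z * Cexp (- s * RtoC (freq k)))%C.
Proof.
  exists (fun i => if (i =? k)%nat then z else RtoC 0), (S k); intros s.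
  rewrite psum_S, (psum_ext _ _ _ (fun _ => RtoC 0)).
  - rewrite csum_zero, dirichlet_termE, Nat.eqb_refl; ring.
  - intros i Hi; apply dirichlet_term_0.
    now rewrite (proj2 (Nat.eqb_neq _ _)) by lia.
Qed.

Lemma dirichlet_poly_plus (F G : C -> C) :
  dirichlet_poly F -> dirichlet_poly G -> dirichlet_poly (fun s => F s + G s)%C.
Proof.
  intros HF HG; apply dirichlet_poly_support in HF, HG.
  destruct HF as [a [M [Ha HF]]], HG as [b [N [Hb HG]]].
  exists (fun k => (a k + b k)%C), (max M N); intros s.
  rewrite (psum_ext _ _ _ (fun k => dirichlet_term a s k + dirichlet_term b s k)%C)
    by (intros; apply dirichlet_term_plus).
  rewrite csum_plus, HF, HG.
  rewrite (csum_support (dirichlet_term a s) M (max M N))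
    by (try lia; intros; apply dirichlet_term_0; auto).
  rewrite (csum_support (dirichlet_term b s) N (max M N))
    by (try lia; intros; apply dirichlet_term_0; auto).
  reflexivity.
Qed.

Lemma dirichlet_poly_ext (F G : C -> C) :
  (forall s, F s = G s) -> dirichlet_poly F -> dirichlet_poly G.
Proof.
  intros E [b [N H]]; exists b, N; intros s; now rewrite <- E.
Qed.

Lemma dirichlet_poly_csum (f : nat -> C -> C) N :
  (forall k, dirichlet_poly (f k)) ->
  dirichlet_poly (fun s => csum (fun k => f k s) N).
Proof.
  intros H; induction N as [|N IH].
  - exists (fun _ => RtoC 0), 0%nat; reflexivity.
  - now apply dirichlet_poly_plus.
Qed.

(** Frequencies add because (i+1)(j+1) = (ij+i+j) + 1, which explains the shifted index
    [i * j + i + j]. Equal indices need not be collected, since sums of monomials are again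
    polynomials. *)
Lemma dirichlet_poly_mult (F G : C -> C) :
  dirichlet_poly F -> dirichlet_poly G -> dirichlet_poly (fun s => F s * G s)%C.
Proof.
  intros [a [M HF]] [b [N HG]].
  apply (dirichlet_poly_ext (fun s => csum (fun i => csum (fun j =>
    a i * b j * Cexp (- s * RtoC (freq (i * j + i + j))))%C N) M)).
  - intros s; rewrite HF, HG, Cmult_comm, <- csum_scal; apply psum_ext; intros i _.
    rewrite Cmult_comm, <- csum_scal; apply psum_ext; intros j _.
    rewrite !dirichlet_termE.
    replace (- s * RtoC (freq (i * j + i + j)))%C
      with (- s * RtoC (freq i) + - s * RtoC (freq j))%C.
    + rewrite Cexp_plus; ring.
    + replace (freq (i * j + i + j)) with (freq i + freq j).
      * rewrite RtoC_plus; ring.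
      * unfold freq; rewrite <- ln_mult, <- mult_INR
          by (apply lt_0_INR; lia); do 2 f_equal; lia.
  - apply dirichlet_poly_csum; intros i; apply dirichlet_poly_csum; intros j.
    apply dirichlet_poly_monomial.
Qed.

(** A stand-in for a Dirichlet series converging uniformly on each Re s > eps: the polynomials may
    vary freely with [eps] and [d] and need not be partial sums of one series, so products and
    limits require no coefficient formulas. *)
Definition approximable (F : C -> C) : Prop :=
  forall eps d, 0 < eps -> 0 < d -> exists p, dirichlet_poly p /\
    forall s, eps < Re s -> Cmod (p s - F s) <= d.

Lemma approximable_poly (F : C -> C) : dirichlet_poly F -> approximable F.
Proof.
  intros H eps d _ Hd; exists F; split; [exact H|]; intros s _.
  replace (F s - F s)%C with (RtoC 0) by ring; rewrite Cmod_0; lra.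
Qed.

Lemma approximable_const (c : C) : approximable (fun _ => c).
Proof.
  apply approximable_poly, (dirichlet_poly_ext _ _) with
    (2 := dirichlet_poly_monomial c 0); intros s.
  unfold freq; change (INR 1) with 1; rewrite ln_1, Cmult_0_r, Cexp_0; ring.
Qed.

Lemma approximable_plus (F G : C -> C) :
  approximable F -> approximable G -> approximable (fun s => F s + G s)%C.
Proof.
  intros HF HG eps d He Hd.
  destruct (HF eps (d / 2) He ltac:(lra)) as [p [Hp HpF]].
  destruct (HG eps (d / 2) He ltac:(lra)) as [q [Hq HqG]].
  exists (fun s => p s + q s)%C; split; [now apply dirichlet_poly_plus|].
  intros s Hs; specialize (HpF s Hs); specialize (HqG s Hs).
  replace (p s + q s - (F s + G s))%C with ((p s - F s) + (q s - G s))%C by ring.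
  pose proof (Cmod_triangle (p s - F s)%C (q s - G s)%C); lra.
Qed.

Lemma approximable_mult (F G : C -> C) A B :
  (forall s, 0 < Re s -> Cmod (F s) <= A) ->
  (forall s, 0 < Re s -> Cmod (G s) <= B) ->
  approximable F -> approximable G -> approximable (fun s => F s * G s)%C.
Proof.
  intros HA HB HF HG eps d He Hd.
  assert (A0 : 0 <= A)
    by (eapply Rle_trans; [apply Cmod_ge_0 | apply (HA (RtoC 1)); simpl; lra]).
  assert (B0 : 0 <= B)
    by (eapply Rle_trans; [apply Cmod_ge_0 | apply (HB (RtoC 1)); simpl; lra]).
  (* d' <= 1 bounds the product of the two errors by d', so the total error is at most (A + B + 1)
     d'. *)
  set (d' := Rmin 1 (d / (A + B + 1))).
  assert (Hd' : 0 < d')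
    by (apply Rmin_glb_lt; [lra | apply Rdiv_lt_0_compat; lra]).
  destruct (HF eps d' He Hd') as [p [Hp HpF]].
  destruct (HG eps d' He Hd') as [q [Hq HqG]].
  exists (fun s => p s * q s)%C; split; [now apply dirichlet_poly_mult|].
  intros s Hs; specialize (HpF s Hs); specialize (HqG s Hs).
  specialize (HA s ltac:(lra)); specialize (HB s ltac:(lra)).
  replace (p s * q s - F s * G s)%C
    with ((p s - F s) * (q s - G s) + (F s * (q s - G s) + G s * (p s - F s)))%C
    by ring.
  eapply Rle_trans; [apply Cmod_triangle|].
  eapply Rle_trans; [apply Rplus_le_compat_l, Cmod_triangle|].
  rewrite !Cmod_mult.
  assert (H1 : d' <= 1) by apply Rmin_l.
  assert (H2 : (A + B + 1) * d' <= d).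
  { apply Rle_trans with ((A + B + 1) * (d / (A + B + 1))).
    - apply Rmult_le_compat_l; [lra | apply Rmin_r].
    - right; field; lra. }
  assert (Cmod (p s - F s) * Cmod (q s - G s) <= 1 * d')
    by (apply Rmult_le_compat; try apply Cmod_ge_0; lra).
  assert (Cmod (F s) * Cmod (q s - G s) <= A * d')
    by (apply Rmult_le_compat; try apply Cmod_ge_0; lra).
  assert (Cmod (G s) * Cmod (p s - F s) <= B * d')
    by (apply Rmult_le_compat; try apply Cmod_ge_0; lra).
  lra.
Qed.

Lemma approximable_limit (F : C -> C) :
  (forall d, 0 < d -> exists G, approximable G /\
    forall s, 0 < Re s -> Cmod (G s - F s) <= d) ->
  approximable F.
Proof.
  intros H eps d He Hd; destruct (H (d / 2) ltac:(lra)) as [G [HG HGF]].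
  destruct (HG eps (d / 2) He ltac:(lra)) as [p [Hp HpG]].
  exists p; split; [exact Hp|]; intros s Hs.
  specialize (HpG s Hs); specialize (HGF s ltac:(lra)).
  pose proof (Cmod_minus_triangle (p s) (G s) (F s)); lra.
Qed.

Lemma approximable_csum (f : nat -> C -> C) N :
  (forall k, approximable (f k)) ->
  approximable (fun s => csum (fun k => f k s) N).
Proof.
  intros H; induction N as [|N IH].
  - exact (approximable_const (RtoC 0)).
  - now apply approximable_plus.
Qed.

Lemma approximable_pow (F : C -> C) A k :
  (forall s, 0 < Re s -> Cmod (F s) <= A) -> approximable F ->
  approximable (fun s => F s ^ k)%C.
Proof.
  intros HA HF; induction k as [|k IH].
  - exact (approximable_const (RtoC 1)).
  - apply (approximable_mult F (fun s => F s ^ k)%C A (A ^ k)); try assumption.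
    intros s Hs; rewrite Cmod_pow; apply pow_incr.
    split; [apply Cmod_ge_0 | now apply HA].
Qed.

(** * Realising bounded approximable functions as elements of H^2 *)

Lemma inv_INR_S_le M N : (M <= N)%nat -> / INR (S N) <= / INR (S M).
Proof.
  intros H; apply Rinv_le_contravar; [apply lt_0_INR; lia | apply le_INR; lia].
Qed.

Lemma inv_INR_S_pos N : 0 < / INR (S N).
Proof. apply Rinv_0_lt_compat, lt_0_INR; lia. Qed.

Lemma inv_INR_S_small (d : R) : 0 < d -> exists N, / INR (S N) < d.
Proof.
  intros Hd; destruct (archimed_cor1 d Hd) as [N [H1 H2]].
  exists N; apply Rle_lt_trans with (2 := H1).
  apply Rinv_le_contravar; [apply lt_0_INR; lia | apply le_INR; lia].
Qed.

Lemma is_lim_seq_inv_INR_S : is_lim_seq (fun N => / INR (S N)) 0.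
Proof.
  apply is_lim_seq_spec; intros e.
  destruct (inv_INR_S_small e (cond_pos e)) as [N HN]; exists N; intros n Hn.
  rewrite Rminus_0_r, Rabs_pos_eq by apply Rlt_le, inv_INR_S_pos.
  apply Rle_lt_trans with (2 := HN), inv_INR_S_le, Hn.
Qed.

(** The centre z is left free: z = 0 passes norm bounds to the limit, z = [beta N] passes distances
    to a fixed polynomial. *)
Lemma rsum_sq_limit_le (u : nat -> nat -> C) (v z : nat -> C) (w : nat -> R) I
  N B :
  (forall i, Clim (fun n => u n i) (v i)) ->
  (forall n, (N <= n)%nat ->
    rsum (fun i => Cmod (z i - u n i) ^ 2 * w i) I <= B) ->
  rsum (fun i => Cmod (z i - v i) ^ 2 * w i) I <= B.
Proof.
  intros Hv H.
  apply (is_lim_seq_le_loc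
    (fun n => rsum (fun i => Cmod (z i - u n i) ^ 2 * w i) I) (fun _ => B)
    (rsum (fun i => Cmod (z i - v i) ^ 2 * w i) I) B).
  - exists N; exact H.
  - apply (is_lim_seq_rsum (fun n i => Cmod (z i - u n i) ^ 2 * w i)); intros i.
    pose proof (is_lim_seq_Cmod _ _ (z i) (Hv i)) as Hi.
    apply is_lim_seq_mult'; [|apply is_lim_seq_const].
    simpl; apply is_lim_seq_mult'; [exact Hi|].
    apply is_lim_seq_mult'; [exact Hi | apply is_lim_seq_const].
  - apply is_lim_seq_const.
Qed.

(** One scale 1/(N+1) governs both the half-plane and the accuracy. The estimate holds for every
    length n >= [D N] because the chosen coefficients vanish beyond [D N]. *)
Lemma approximable_coefs (F : C -> C) : approximable F ->
  exists (beta : nat -> nat -> C) (D : nat -> nat),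
    forall N n s, (D N <= n)%nat -> / INR (S N) < Re s ->
      Cmod (csum (dirichlet_term (beta N) s) n - F s) <= / INR (S N).
Proof.
  intros HF.
  destruct (choice (fun N (p : (nat -> C) * nat) => forall n s,
    (snd p <= n)%nat -> / INR (S N) < Re s ->
      Cmod (csum (dirichlet_term (fst p) s) n - F s) <= / INR (S N)))
    as [p Hp].
  - intros N; pose proof (inv_INR_S_pos N) as He.
    destruct (HF _ _ He He) as [q [Hq HqF]].
    apply dirichlet_poly_support in Hq; destruct Hq as [b [D [Hb E]]].
    exists (b, D); intros n s Hn Hs; simpl in *.
    rewrite (csum_support _ D n), <- E; auto.
    intros; now apply dirichlet_term_0, Hb.
  - exists (fun N => fst (p N)), (fun N => snd (p N)); exact Hp.
Qed.

(* Comparing coefficients of approximating polynomials on vertical lines close to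
   the imaginary axis replaces the boundary-value argument for the inclusion of
   bounded Dirichlet series in H^2. *)
Lemma approximable_H2 (F : C -> C) B : approximable F ->
  (forall s, 0 < Re s -> Cmod (F s) <= B) ->
  exists e : H2, H2_norm e <= B /\
    forall s, 1 / 2 < Re s -> H2_eval e s = F s.
Proof.
  intros HF HB; destruct (approximable_coefs F HF) as [beta [D Hb]].
  assert (B0 : 0 <= B)
    by (eapply Rle_trans; [apply Cmod_ge_0 | apply (HB (RtoC 1)); simpl; lra]).
  (* On Re s = sigma both polynomials lie within 1/(N0+1) of F. The sum is lengthened to m so that
     both are complete. *)
  assert (Hdiff : forall N0 M N sigma n, (N0 <= M)%nat -> (N0 <= N)%nat ->
    / INR (S N0) < sigma ->
    rsum (fun k => Cmod (beta M k - beta N k) ^ 2 *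
      exp (- (2 * sigma) * freq k)) n <= (2 * / INR (S N0)) ^ 2).
  { intros N0 M N sigma n HM HN Hs; set (m := max n (max (D M) (D N))).
    apply Rle_trans with (rsum (fun k => Cmod (beta M k - beta N k) ^ 2 *
      exp (- (2 * sigma) * freq k)) m).
    - apply rsum_mono; [|unfold m; lia].
      intros k; apply Rmult_le_pos; [apply pow2_ge_0 | apply Rlt_le, exp_pos].
    - apply (dirichlet_mean_square (fun k => (beta M k - beta N k)%C)).
      intros s E; subst sigma; rewrite csum_dirichlet_minus.
      pose proof (inv_INR_S_le _ _ HM) as H1; pose proof (inv_INR_S_le _ _ HN) as H2.
      pose proof (Hb M m s ltac:(unfold m; lia) ltac:(lra)) as H3.
      pose proof (Hb N m s ltac:(unfold m; lia) ltac:(lra)) as H4.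
      rewrite Cmod_minus_sym in H4.
      eapply Rle_trans; [apply (Cmod_minus_triangle _ (F s))|]; lra. }
  (* Each coefficient sequence is Cauchy by [Hdiff] on the line sigma = 2; removing the weight costs
     e^(2 [freq k]), a constant for fixed k. *)
  destruct (choice (fun k l => Clim (fun N => beta N k) l)) as [e He].
  { intros k; apply Clim_cauchy; intros d Hd.
    pose proof (exp_pos (2 * freq k)) as Hk.
    destruct (inv_INR_S_small (d / (2 * exp (2 * freq k)))) as [N HN];
      [apply Rdiv_lt_0_compat; lra|].
    exists N; intros m n Hm Hn.
    apply Rle_trans with (2 * / INR (S N) * exp (2 * freq k)).
    - apply le_of_weighted_sq_le; [apply Cmod_ge_0 | |].
      { pose proof (inv_INR_S_pos N); lra. }
      eapply Rle_trans; [|apply (Hdiff N m n 2 (S k) Hm Hn)].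
      + apply (rsum_term_le (fun k => Cmod (beta m k - beta n k) ^ 2 *
          exp (- (2 * 2) * freq k))); [|lia].
        intros i; apply Rmult_le_pos; [apply pow2_ge_0 | apply Rlt_le, exp_pos].
      + pose proof (inv_INR_S_le 0 N ltac:(lia)) as H; simpl INR in H at 2; lra.
    - replace d with (d / (2 * exp (2 * freq k)) * (2 * exp (2 * freq k)))
        by (field; lra).
      replace (2 * / INR (S N) * exp (2 * freq k))
        with (/ INR (S N) * (2 * exp (2 * freq k))) by ring.
      apply Rmult_le_compat_r; lra. }
  (* Two limits in succession: N to infinity on the line sigma = 1/(j+1), with bound B + 1/(j+1),
     and then j to infinity, which removes both the weight and the excess. *)
  assert (Hnorm : forall n, rsum (fun k => Cmod (e k) ^ 2) n <= B ^ 2).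
  { intros n.
    apply (is_lim_seq_le
      (fun j => rsum (fun k => Cmod (e k) ^ 2 *
        exp (- (2 * / INR (S j)) * freq k)) n)
      (fun j => (B + / INR (S j)) ^ 2)
      (rsum (fun k => Cmod (e k) ^ 2) n) (B ^ 2)).
    - intros j.
      rewrite (psum_ext _ _ _ (fun k => Cmod (RtoC 0 - e k) ^ 2 *
        exp (- (2 * / INR (S j)) * freq k))).
      2:{ intros k _; do 2 f_equal; rewrite <- Cmod_opp; f_equal; ring. }
      (* The threshold is [S j] rather than j: the line sigma = 1/(j+1) must lie strictly inside Re
         s > 1/(N+1). *)
      apply (rsum_sq_limit_le beta e (fun _ => RtoC 0)
        (fun k => exp (- (2 * / INR (S j)) * freq k)) n (S j)); [exact He|].
      intros N HN; set (m := max n (D N)).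
      rewrite (psum_ext _ _ _ (fun k => Cmod (beta N k) ^ 2 *
        exp (- (2 * / INR (S j)) * freq k))).
      2:{ intros k _; do 2 f_equal; rewrite <- Cmod_opp; f_equal; ring. }
      apply Rle_trans with (rsum (fun k => Cmod (beta N k) ^ 2 *
        exp (- (2 * / INR (S j)) * freq k)) m).
      + apply rsum_mono; [|unfold m; lia].
        intros k; apply Rmult_le_pos; [apply pow2_ge_0 | apply Rlt_le, exp_pos].
      + apply dirichlet_mean_square; intros s Hs.
        assert (Hlt : / INR (S N) < / INR (S j))
          by (apply Rinv_lt_contravar;
              [apply Rmult_lt_0_compat; apply lt_0_INR; lia | apply lt_INR; lia]).
        pose proof (inv_INR_S_pos j).
        pose proof (Hb N m s ltac:(unfold m; lia) ltac:(lra)).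
        pose proof (HB s ltac:(lra)).
        replace (csum (dirichlet_term (beta N) s) m)
          with ((csum (dirichlet_term (beta N) s) m - F s) + F s)%C by ring.
        eapply Rle_trans; [apply Cmod_triangle|]; lra.
    - apply (is_lim_seq_rsum (fun j k => Cmod (e k) ^ 2 *
        exp (- (2 * / INR (S j)) * freq k))); intros k.
      assert (E0 : Cmod (e k) ^ 2 = Cmod (e k) ^ 2 * exp (- (2 * 0) * freq k))
        by (replace (- (2 * 0) * freq k) with 0 by ring; rewrite exp_0; ring).
      assert (L := is_lim_seq_continuous
        (fun x => Cmod (e k) ^ 2 * exp (- (2 * x) * freq k))
        (fun j => / INR (S j)) 0).
      cbv beta in L; rewrite <- E0 in L; apply L;
        [|apply is_lim_seq_inv_INR_S]; clear L E0.
      apply continuity_pt_filterlim, (ex_derive_continuous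
        (fun x => Cmod (e k) ^ 2 * exp (- (2 * x) * freq k))).
      auto_derive; trivial.
    - replace (B ^ 2) with ((B + 0) ^ 2) by ring.
      apply (is_lim_seq_continuous (fun x => (B + x) ^ 2));
        [|apply is_lim_seq_inv_INR_S].
      apply continuity_pt_filterlim,
        (ex_derive_continuous (fun x => (B + x) ^ 2)).
      auto_derive; trivial. }
  assert (Hsum : ex_series (fun k => Cmod (e k) ^ 2))
    by (apply (ex_series_bounded _ (B ^ 2)); [intros; apply pow2_ge_0|exact Hnorm]).
  exists (mkH2 e Hsum); split.
  - unfold H2_norm; simpl coef; rewrite <- (sqrt_pow2 B) by exact B0.
    apply sqrt_le_1_alt; now apply Series_le_bound.
  - intros s Hs.
    change (dirichlet e s = F s); apply (Clim_csum_Series (dirichlet_term e s)).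
    intros d Hd; set (x := Re s - 1 / 2).
    assert (Hx : 0 < x) by (unfold x; lra).
    assert (Hix : 0 < / x) by now apply Rinv_0_lt_compat.
    set (Z := sqrt (1 + / x)); assert (HZ : 0 <= Z) by apply sqrt_pos.
    (* The first bound makes [Hdiff] applicable at sigma = x/2; the second makes the total error (2Z
       + 1)/(N+1) at most d. *)
    destruct (inv_INR_S_small (Rmin (x / 2) (d / (2 * Z + 1)))) as [N HN].
    { apply Rmin_glb_lt; [lra | apply Rdiv_lt_0_compat; lra]. }
    assert (HN1 : / INR (S N) < x / 2)
      by (eapply Rlt_le_trans; [exact HN | apply Rmin_l]).
    assert (HN2 : / INR (S N) * (2 * Z + 1) <= d).
    { replace d with (d / (2 * Z + 1) * (2 * Z + 1)) by (field; lra).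
      apply Rmult_le_compat_r; [lra|].
      apply Rlt_le, Rlt_le_trans with (1 := HN), Rmin_r. }
    pose proof (inv_INR_S_pos N) as HN3.
    exists (D N); intros n Hn.
    assert (Hclose : Cmod (csum (dirichlet_term e s) n -
      csum (dirichlet_term (beta N) s) n) <= 2 * / INR (S N) * Z).
    { rewrite Cmod_minus_sym, <- csum_dirichlet_minus.
      eapply Rle_trans; [apply Cmod_csum_le|].
      (* Re s = 1/2 + x is split as x/2 + (1+x)/2: the first exponent weights the coefficient
         distance controlled by [Hdiff], the second squares to the convergent sum of
         (k+1)^(-(1+x)). *)
      rewrite (psum_ext _ _ _ (fun k =>
        Cmod (beta N k - e k) * exp (- (x / 2) * freq k) *
        exp (- ((1 + x) / 2) * freq k))).
      2:{ intros k _; rewrite Cmod_dirichlet_term, Rmult_assoc, <- exp_plus.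
          do 2 f_equal; unfold x; field. }
      apply cauchy_schwarz_le; [lra | exact HZ | |].
      - rewrite (psum_ext _ _ _ (fun k => Cmod (beta N k - e k) ^ 2 *
          exp (- (2 * (x / 2)) * freq k))).
        + apply (rsum_sq_limit_le beta e (beta N) (fun k =>
            exp (- (2 * (x / 2)) * freq k)) n N); [exact He|].
          intros M HM; now apply Hdiff.
        + intros k _; rewrite Rpow_mult_distr; f_equal; simpl.
          rewrite Rmult_1_r, <- exp_plus; f_equal; field.
      - unfold Z; rewrite pow2_sqrt by lra.
        rewrite (psum_ext _ _ _ (fun k => exp (- (1 + x) * freq k))).
        + now apply zeta_bound.
        + intros k _; simpl; rewrite Rmult_1_r, <- exp_plus; f_equal; field. }
    eapply Rle_trans;
      [apply (Cmod_minus_triangle _ (csum (dirichlet_term (beta N) s) n))|].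
    pose proof (Hb N n s Hn ltac:(unfold x in *; lra)); lra.
Qed.

(** * Compact subsets of the half-plane *)

(** A finite subcover of an increasing family is contained in its member of largest index. *)
Lemma compact_exhaustion {U : UniformSpace} (K : U -> Prop)
  (V : nat -> U -> Prop) : compact_set K -> (forall j, open (V j)) ->
  (forall i j x, (i <= j)%nat -> V i x -> V j x) ->
  (forall x, K x -> exists j, V j x) -> exists j, forall x, K x -> V j x.
Proof.
  intros HK HV Hmono Hcov.
  destruct (HK (fun O => exists j, O = V j)) as [l [Hl HKl]].
  - intros O [j E]; subst; apply HV.
  - intros x Hx; destruct (Hcov x Hx) as [j Hj]; exists (V j); eauto.
  - assert (H : exists j, forall O, In O l -> forall x, O x -> V j x).
    { clear HKl; induction Hl as [|O l [i E] _ [j Hj]].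
      - exists 0%nat; intros O [].
      - exists (max i j); intros O' [E'|HO'] x Hx.
        + subst; apply (Hmono i); [lia | exact Hx].
        + apply (Hmono j); [lia | now apply (Hj O')]. }
    destruct H as [j Hj]; exists j; intros x Hx.
    apply HKl, Exists_exists in Hx; destruct Hx as [O [HO Hx]]; eauto.
Qed.

Lemma compact_halfplane_bounds (K : C -> Prop) :
  compact_set (U := C_UniformSpace) K -> (forall w, K w -> halfplane (1 / 2) w) ->
  exists j : nat, forall w, K w -> 1 / 2 + / INR (S j) < Re w /\ Cmod w < INR j.
Proof.
  intros HK Hsub.
  apply (compact_exhaustion (U := C_UniformSpace) K
    (fun j w => 1 / 2 + / INR (S j) < Re w /\ Cmod w < INR j) HK).
  - intros j w [H1 H2].
    (* The modulus gap is halved because the ball is a square: |y - w| is bounded by the sum of two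
       coordinate differences, each below e. *)
    set (e := Rmin (Re w - (1 / 2 + / INR (S j))) ((INR j - Cmod w) / 2)).
    assert (He : 0 < e) by (apply Rmin_glb_lt; lra).
    exists (mkposreal e He); intros y [B1 B2].
    change (Rabs (Re y - Re w) < e) in B1; change (Rabs (Im y - Im w) < e) in B2.
    assert (L1 : e <= Re w - (1 / 2 + / INR (S j))) by apply Rmin_l.
    assert (L2 : e <= (INR j - Cmod w) / 2) by apply Rmin_r.
    split; [apply Rabs_def2 in B1; lra|].
    replace y with ((y - w) + w)%C by ring.
    pose proof (Cmod_triangle (y - w)%C w); pose proof (Cmod_le_parts (y - w)%C) as H0.
    change (Re (y - w)%C) with (Re y - Re w) in H0.
    change (Im (y - w)%C) with (Im y - Im w) in H0; lra.
  - intros i j w Hij [H1 H2]; pose proof (inv_INR_S_le _ _ Hij).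
    pose proof (le_INR _ _ Hij); lra.
  - intros w Hw; specialize (Hsub w Hw); unfold halfplane in Hsub.
    destruct (inv_INR_S_small (Re w - 1 / 2)) as [i Hi]; [lra|].
    destruct (INR_unbounded (Cmod w)) as [j Hj].
    exists (max i j); pose proof (inv_INR_S_le i (max i j) ltac:(lia)).
    pose proof (le_INR j (max i j) ltac:(lia)); lra.
Qed.

(** Discs of centre a and radius just below a - 1/2 fill the half-plane as a grows, so a bounded set
    at positive distance from the line fits into one of them. *)
Lemma compact_in_disc (K : C -> Prop) :
  compact_set (U := C_UniformSpace) K -> (forall w, K w -> halfplane (1 / 2) w) ->
  exists a rho : R, 0 < rho < a - 1 / 2 /\
    forall w, K w -> Cmod (w - RtoC a) <= rho.
Proof.
  intros HK Hsub; destruct (compact_halfplane_bounds K HK Hsub) as [j Hj].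
  set (k := / INR (S j)) in *; assert (Hk : 0 < k) by apply inv_INR_S_pos.
  set (B := INR j) in *; assert (HB : 0 <= B) by apply pos_INR.
  (* From |w - a|^2 = |w|^2 - 2a Re w + a^2 <= X, the requirement X < (a - 1/2)^2 reads B^2 - 2ak <
     1/4, and this choice gives ak = k + B^2. *)
  set (a := 1 + B ^ 2 / k).
  assert (Ha : 1 <= a).
  { assert (0 <= B ^ 2 / k)
      by (apply Rmult_le_pos; [apply pow2_ge_0 | now apply Rlt_le, Rinv_0_lt_compat]).
    unfold a; lra. }
  assert (Hak : a * k = k + B ^ 2) by (unfold a; field; lra).
  set (X := B ^ 2 - 2 * a * (1 / 2 + k) + a ^ 2).
  assert (HX : X < (a - 1 / 2) ^ 2) by (unfold X; nra).
  assert (HY : sqrt (Rmax 0 X) < a - 1 / 2).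
  { rewrite <- (sqrt_pow2 (a - 1 / 2)) by lra; apply sqrt_lt_1_alt.
    split; [apply Rmax_l|]; apply Rmax_lub_lt; [nra | exact HX]. }
  pose proof (sqrt_pos (Rmax 0 X)).
  (* The midpoint keeps rho positive even if X <= 0, and still below a - 1/2. *)
  exists a, ((sqrt (Rmax 0 X) + (a - 1 / 2)) / 2); split; [lra|].
  intros w Hw; destruct (Hj w Hw) as [H1 H2].
  apply Rle_trans with (sqrt (Rmax 0 X)); [|lra].
  rewrite <- (sqrt_pow2 (Cmod (w - RtoC a))) by apply Cmod_ge_0.
  apply sqrt_le_1_alt; apply Rle_trans with X; [|apply Rmax_r].
  assert (E : Cmod (w - RtoC a) ^ 2 = Cmod w ^ 2 - 2 * a * Re w + a ^ 2).
  { rewrite !Cmod2_alt; destruct w; simpl; ring. }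
  rewrite E; unfold X; pose proof (Cmod_ge_0 w).
  assert (Cmod w ^ 2 <= B ^ 2) by (apply pow_incr; lra).
  assert (a * (1 / 2 + k) <= a * Re w) by (apply Rmult_le_compat_l; lra); lra.
Qed.

(** * Finite-rank operators *)

Definition linear_form (alpha : H2 -> C) : Prop :=
  (forall f g, alpha (H2_plus f g) = (alpha f + alpha g)%C) /\
  (forall c f, alpha (H2_scal c f) = (c * alpha f)%C).

Definition finite_rank (alpha : nat -> H2 -> C) (v : nat -> H2) (n : nat)
  (f : H2) : H2 :=
  hsum (fun k => H2_scal (alpha k f) (v k)) n.

Lemma finite_rank_plus alpha v n f g : (forall k, linear_form (alpha k)) ->
  finite_rank alpha v n (H2_plus f g) =
  H2_plus (finite_rank alpha v n f) (finite_rank alpha v n g).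
Proof.
  intros H; unfold finite_rank; induction n as [|n IH]; simpl.
  - apply H2_ext; intros k; simpl; ring.
  - rewrite IH, (proj1 (H n)); apply H2_ext; intros k; simpl; ring.
Qed.

Lemma finite_rank_scal alpha v n c f : (forall k, linear_form (alpha k)) ->
  finite_rank alpha v n (H2_scal c f) = H2_scal c (finite_rank alpha v n f).
Proof.
  intros H; unfold finite_rank; induction n as [|n IH]; simpl.
  - apply H2_ext; intros k; simpl; ring.
  - rewrite IH, (proj2 (H n)); apply H2_ext; intros k; simpl; ring.
Qed.

(* Elimination: a vector [y] with [alpha n y = 1] splits off its image, and
   [f - alpha n f y] is only seen by the remaining [n] forms. *)
Lemma finite_rank_span alpha v n : (forall k, linear_form (alpha k)) ->
  exists m e, (m <= n)%nat /\ forall f, exists a : nat -> C,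
    finite_rank alpha v n f =
    hsum (fun i => H2_scal (a i) (finite_rank alpha v n (e i))) m.
Proof.
  revert alpha; induction n as [|n IH]; intros alpha H.
  - exists 0%nat, (fun _ => H2_zero); split; [lia|].
    intros f; exists (fun _ => RtoC 0); reflexivity.
  - destruct (Classical_Prop.classic (exists x, alpha n x <> RtoC 0))
      as [[x Hx]|Hno].
    + set (y := H2_scal (/ alpha n x) x).
      assert (Hy : alpha n y = RtoC 1)
        by (unfold y; rewrite (proj2 (H n)); now apply Cinv_l).
      set (P f := H2_plus f (H2_scal (- alpha n f) y)).
      assert (HP : forall k f,
        alpha k (P f) = (alpha k f - alpha n f * alpha k y)%C)
        by (intros k f; unfold P; rewrite (proj1 (H k)), (proj2 (H k)); ring).
      destruct (IH (fun k f => alpha k (P f))) as [m [e [Hm He]]].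
      { intros k; split; intros; rewrite !HP, !(proj1 (H _))
        || rewrite !HP, !(proj2 (H _));
          ring. }
      assert (HS : forall f, finite_rank (fun k f => alpha k (P f)) v n f =
        finite_rank alpha v (S n) (P f)).
      { intros f; unfold finite_rank; simpl; rewrite (HP n), Hy.
        apply H2_ext; intros k; simpl; ring. }
      exists (S m), (fun i => if (i <? m)%nat then P (e i) else y).
      split; [lia|]; intros f; destruct (He f) as [a Ha].
      exists (fun i => if (i <? m)%nat then a i else alpha n f).
      rewrite psum_S, Nat.ltb_irrefl.
      rewrite (psum_ext _ _ _ (fun i =>
        H2_scal (a i) (finite_rank (fun k f => alpha k (P f)) v n (e i)))).
      * rewrite <- Ha, HS, <- finite_rank_scal, <- finite_rank_plus by exact H.
        f_equal; unfold P; apply H2_ext; intros k; simpl; ring.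
      * intros i Hi; now rewrite (proj2 (Nat.ltb_lt _ _) Hi), HS.
    + assert (HS : forall f, finite_rank alpha v (S n) f = finite_rank alpha v n f).
      { intros f; unfold finite_rank; simpl.
        replace (alpha n f) with (RtoC 0).
        - apply H2_ext; intros k; simpl; ring.
        - destruct (Classical_Prop.classic (alpha n f = RtoC 0)); [easy|].
          exfalso; eauto. }
      destruct (IH alpha H) as [m [e [Hm He]]]; exists m, e; split; [lia|].
      intros f; destruct (He f) as [a Ha]; exists a.
      rewrite HS, Ha; apply psum_ext; intros i _; now rewrite HS.
Qed.

Lemma sum_n_m_hsum (u : nat -> H2) m :
  sum_n_m u 1 m = hsum (fun i => u (S i)) m.
Proof.
  induction m as [|m IH].
  - exact (sum_n_m_zero u 1 0 (Nat.lt_0_succ 0)).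
  - rewrite sum_n_Sm, IH by lia; reflexivity.
Qed.

(** [rank_lt] asks for spanning vectors that are values of the operator, which the [v k] need not
    be; hence the detour through [finite_rank_span]. The shift by one arises because [sum_n_m]
    starts at 1. *)
Lemma finite_rank_rank_lt alpha v n : (forall k, linear_form (alpha k)) ->
  rank_lt (K := C_AbsRing) (finite_rank alpha v n) (S n).
Proof.
  intros H; destruct (finite_rank_span alpha v n H) as [m [e [Hm He]]].
  exists m, (fun i => e (i - 1)%nat); split; [lia|].
  intros f; destruct (He f) as [a Ha]; exists (fun i => a (i - 1)%nat).
  rewrite sum_n_m_hsum, Ha; apply psum_ext; intros i _; simpl.
  now rewrite Nat.sub_0_r.
Qed.

Lemma finite_rank_is_linear alpha v n : (forall k, linear_form (alpha k)) ->
  (forall k, exists M, forall f, Cmod (alpha k f) <= M * H2_norm f) ->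
  is_linear (K := C_AbsRing) (finite_rank alpha v n).
Proof.
  intros H Hb; split.
  - intros f g; now apply finite_rank_plus.
  - intros c f; now apply finite_rank_scal.
  - induction n as [|n [M [HM0 HM]]].
    + exists 1; split; [lra|]; intros f; change (H2_norm H2_zero <= 1 * H2_norm f).
      replace H2_zero with (H2_scal 0 f) by (apply H2_ext; intros; simpl; ring).
      eapply Rle_trans; [apply H2_norm_scal|]; rewrite Cmod_0.
      pose proof (H2_norm_ge0 f); lra.
    + destruct (Hb n) as [A HA].
      pose proof (H2_norm_ge0 (v n)) as Hv; pose proof (Rabs_pos A).
      exists (M + Rabs A * H2_norm (v n)); split.
      { pose proof (Rmult_le_pos _ _ H0 Hv); lra. }
      intros f; change (H2_norm (H2_plus (finite_rank alpha v n f)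
        (H2_scal (alpha n f) (v n))) <= (M + Rabs A * H2_norm (v n)) * H2_norm f).
      eapply Rle_trans; [apply H2_norm_triangle|].
      specialize (HM f).
      change (H2_norm (finite_rank alpha v n f) <= M * H2_norm f) in HM.
      pose proof (H2_norm_scal (alpha n f) (v n)).
      assert (Cmod (alpha n f) <= Rabs A * H2_norm f).
      { eapply Rle_trans; [apply HA|]; apply Rmult_le_compat_r;
          [apply H2_norm_ge0 | apply Rle_abs]. }
      pose proof (Rmult_le_compat_r _ _ _ Hv H2); lra.
Qed.

(** [approx_num] only admits operators whose [op_norm] is [Finite d]. The bound B excludes plus
    infinity, and the value at zero excludes minus infinity. *)
Lemma op_norm_finite {K : AbsRing} {U V : NormedModule K} (T : U -> V) (B : R) :
  (forall x, norm x <= 1 -> norm (T x) <= B) ->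
  exists d, op_norm T = Finite d /\ d <= B.
Proof.
  intros H; unfold op_norm.
  set (E := fun y => exists x : U, norm x <= 1 /\ y = norm (T x)).
  destruct (Lub_Rbar_correct E) as [Hub Hlub].
  assert (HB : Rbar_le (Lub_Rbar E) B).
  { apply Hlub; intros y [x [Hx Ey]]; subst; now apply H. }
  assert (H0 : E (norm (T zero))).
  { exists zero; split; [rewrite norm_zero; lra | reflexivity]. }
  specialize (Hub _ H0); destruct (Lub_Rbar E) as [d| |]; simpl in *;
    [eauto | contradiction | contradiction].
Qed.

Lemma approx_num_le {K : AbsRing} {U V : NormedModule K} (T S : U -> V) n B :
  is_linear S -> rank_lt S n ->
  (forall x, norm x <= 1 -> norm (minus (T x) (S x)) <= B) ->
  Rbar_le (approx_num T n) B.
Proof.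
  intros HS Hr HB; destruct (op_norm_finite _ B HB) as [d [Ed Hd]].
  apply Rbar_le_trans with (Finite d); [|exact Hd].
  apply (proj1 (Glb_Rbar_correct _)); exists S; auto.
Qed.

(** * Taylor expansion of the elements of H^2 *)

(* The [k]-th Taylor coefficient at [w = a] of [sum_(m < M) f m (m + 1)^(-w)]. *)
Definition taylor_coef (a : R) (M k : nat) (f : H2) : C :=
  csum (fun m => f m * (Cexp (- RtoC a * RtoC (freq m)) *
    exp_term (RtoC (- freq m)) k))%C M.

Lemma taylor_coef_linear a M k : linear_form (taylor_coef a M k).
Proof.
  split.
  - intros f g; unfold taylor_coef; rewrite <- csum_plus.
    apply psum_ext; intros; simpl; ring.
  - intros c f; unfold taylor_coef; rewrite <- csum_scal.
    apply psum_ext; intros; simpl; ring.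
Qed.

(** Purely qualitative: the constant may grow with M and k, since it only serves the boundedness
    inside [is_linear]. *)
Lemma taylor_coef_bounded a M k :
  exists A, forall f, Cmod (taylor_coef a M k f) <= A * H2_norm f.
Proof.
  set (g m := (Cexp (- RtoC a * RtoC (freq m)) *
    exp_term (RtoC (- freq m)) k)%C).
  exists (rsum (fun m => Cmod (g m)) M); intros f.
  eapply Rle_trans; [apply Cmod_csum_le|].
  rewrite Rmult_comm, <- rsum_scal; apply rsum_le; intros m _.
  rewrite Cmod_mult; apply Rmult_le_compat_r; [apply Cmod_ge_0|].
  apply H2_coef_le_norm.
Qed.

(** Square root of an upper bound for zeta(2 theta), hence a bound for the norm of point evaluation
    on Re s = theta. *)
Definition zeta_const (theta : R) : R := sqrt (1 + / (2 * theta - 1)).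

(** [Cexp_remainder] with q = R1/rho bounds the remainder of (m+1)^(-(w-a)) by (rho/R1)^n (m+1)^R1.
    Together with the factor (m+1)^(-a) this leaves (m+1)^(-(a-R1)), which is square summable, so
    Cauchy-Schwarz gives a bound independent of M. *)
Lemma taylor_remainder (a rho R1 : R) (f : H2) (w : C) M n :
  0 < rho -> rho <= R1 -> 1 / 2 < a - R1 -> Cmod (w - RtoC a) <= rho ->
  Cmod (csum (dirichlet_term f w) M -
    csum (fun k => taylor_coef a M k f * (w - RtoC a) ^ k)%C n) <=
  H2_norm f * ((rho / R1) ^ n * zeta_const (a - R1)).
Proof.
  intros Hrho HR Ha Hw.
  set (z m := (- (w - RtoC a) * RtoC (freq m))%C).
  set (u m := (f m * Cexp (- RtoC a * RtoC (freq m)))%C).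
  (* The Taylor polynomial is regrouped by frequency, so that each term carries its own exponential
     remainder. *)
  replace (csum (fun k => taylor_coef a M k f * (w - RtoC a) ^ k)%C n)
    with (csum (fun m => u m * csum (exp_term (z m)) n)%C M).
  - rewrite (psum_ext _ _ (dirichlet_term f w) (fun m => u m * Cexp (z m))%C).
    2:{ intros m _; unfold u, z; rewrite dirichlet_termE, <- Cmult_assoc, <- Cexp_plus.
        do 2 f_equal; ring. }
    rewrite <- csum_minus.
    eapply Rle_trans; [apply Cmod_csum_le|].
    assert (Hr : 0 < (rho / R1) ^ n)
      by (apply pow_lt, Rdiv_lt_0_compat; lra).
    apply Rle_trans with (rsum (fun m => (rho / R1) ^ n *
      (Cmod (f (0 + m)%nat) * exp (- (a - R1) * freq m))) M).
    + apply rsum_le; intros m _; simpl Nat.add.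
      replace (u m * Cexp (z m) - u m * csum (exp_term (z m)) n)%C
        with (u m * (Cexp (z m) - csum (exp_term (z m)) n))%C by ring.
      unfold u; rewrite !Cmod_mult, Cmod_Cexp.
      replace (Re (- RtoC a * RtoC (freq m))) with (- a * freq m) by (simpl; ring).
      pose proof (Cexp_remainder (R1 / rho) (z m) n) as Hrem.
      replace (/ (R1 / rho)) with (rho / R1) in Hrem by (field; lra).
      assert (Hq : 1 <= R1 / rho).
      { apply Rmult_le_reg_r with rho; [exact Hrho|].
        unfold Rdiv; rewrite Rmult_assoc, Rinv_l; lra. }
      specialize (Hrem Hq).
      assert (Hz : R1 / rho * Cmod (z m) <= R1 * freq m).
      { unfold z; rewrite Cmod_mult, Cmod_opp, Cmod_R, Rabs_pos_eq by apply freq_ge0.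
        replace (R1 * freq m) with (R1 / rho * (rho * freq m)) by (field; lra).
        apply Rmult_le_compat_l; [lra|].
        apply Rmult_le_compat_r; [apply freq_ge0 | exact Hw]. }
      replace (exp (- (a - R1) * freq m))
        with (exp (- a * freq m) * exp (R1 * freq m))
        by (rewrite <- exp_plus; f_equal; ring).
      replace ((rho / R1) ^ n * (Cmod (f m) * (exp (- a * freq m) * exp (R1 * freq m))))
        with (Cmod (f m) * exp (- a * freq m) * ((rho / R1) ^ n * exp (R1 * freq m)))
        by ring.
      apply Rmult_le_compat_l.
      { apply Rmult_le_pos; [apply Cmod_ge_0 | apply Rlt_le, exp_pos]. }
      apply Rle_trans with (1 := Hrem), Rmult_le_compat_l; [lra|].
      now apply exp_le_exp.
    + rewrite rsum_scal.
      replace (H2_norm f * ((rho / R1) ^ n * zeta_const (a - R1)))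
        with ((rho / R1) ^ n * (H2_norm f * zeta_const (a - R1))) by ring.
      apply Rmult_le_compat_l; [lra|].
      apply H2_block_le; [apply sqrt_pos | intros; apply Rlt_le, exp_pos |].
      assert (0 < / (2 * (a - R1) - 1)) by (apply Rinv_0_lt_compat; lra).
      unfold zeta_const; rewrite pow2_sqrt by lra.
      rewrite (psum_ext _ _ _
        (fun k => exp (- (1 + (2 * (a - R1) - 1)) * freq k))).
      * apply zeta_bound; lra.
      * intros k _; simpl; rewrite Rmult_1_r, <- exp_plus; f_equal; ring.
  - transitivity (csum (fun m => csum (fun k => u m * exp_term (z m) k)%C n) M).
    { apply psum_ext; intros; symmetry; apply csum_scal. }
    rewrite csum_exchange; apply psum_ext; intros k _.
    unfold taylor_coef; rewrite Cmult_comm, <- csum_scal.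
    apply psum_ext; intros m _; unfold u, z, exp_term.
    replace (- (w - RtoC a) * RtoC (freq m))%C
      with ((w - RtoC a) * RtoC (- freq m))%C by (rewrite RtoC_opp; ring).
    rewrite Cpow_mult_l; ring.
Qed.

(** The order of quantifiers matters: M depends on d but not on f, w or n, so the forms
    [taylor_coef a M k] are the same for all f. *)
Lemma taylor_error (a rho R1 d : R) : 0 < rho -> rho <= R1 -> 1 / 2 < a - R1 ->
  0 < d -> exists M, forall (f : H2) (w : C) n, Cmod (w - RtoC a) <= rho ->
    Cmod (H2_eval f w - csum (fun k => taylor_coef a M k f * (w - RtoC a) ^ k)%C n)
    <= H2_norm f * (d + (rho / R1) ^ n * zeta_const (a - R1)).
Proof.
  intros Hrho HR Ha Hd.
  destruct (H2_eval_tail (a - rho) d ltac:(lra) Hd) as [M HM].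
  exists M; intros f w n Hw.
  pose proof (taylor_remainder a rho R1 f w M n Hrho HR Ha Hw) as H1.
  assert (Hre : a - rho <= Re w).
  { pose proof (re_le_Cmod (w - RtoC a)%C) as H.
    change (Re (w - RtoC a)%C) with (Re w - a) in H.
    pose proof (Rle_abs (- (Re w - a))); rewrite Rabs_Ropp in *; lra. }
  specialize (HM f w M Hre (Nat.le_refl M)).
  eapply Rle_trans; [apply (Cmod_minus_triangle _ (csum (dirichlet_term f w) M))|].
  lra.
Qed.

(** * Approximability of f o phi and the truncated operator *)

Lemma approximable_power_sum (F : C -> C) A (b : nat -> C) n :
  (forall s, 0 < Re s -> Cmod (F s) <= A) -> approximable F ->
  approximable (fun s => csum (fun k => b k * F s ^ k)%C n).
Proof.
  intros HA HF; apply (approximable_csum (fun k s => b k * F s ^ k)%C); intros k.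
  apply (approximable_mult (fun _ => b k) (fun s => F s ^ k)%C
    (Cmod (b k)) (A ^ k)).
  - intros; lra.
  - intros s Hs; rewrite Cmod_pow; apply pow_incr.
    split; [apply Cmod_ge_0 | now apply HA].
  - apply approximable_const.
  - now apply (approximable_pow F A).
Qed.

(** For fixed f, f o phi is a uniform limit on Re s > 0 of polynomials in phi - a, whose powers are
    approximable because phi - a is bounded there. *)
Lemma approximable_comp (phi : C -> C) (a rho : R) (f : H2) :
  0 < rho < a - 1 / 2 -> approximable phi ->
  (forall s, 0 < Re s -> Cmod (phi s - RtoC a) <= rho) ->
  approximable (fun s => H2_eval f (phi s)).
Proof.
  intros Hrho Hphi Hb; set (R1 := (rho + (a - 1 / 2)) / 2).
  assert (Hpsi : approximable (fun s => phi s - RtoC a)%C)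
    by (apply approximable_plus; [exact Hphi | apply approximable_const]).
  apply approximable_limit; intros d Hd.
  set (Z := zeta_const (a - R1)); assert (HZ : 0 <= Z) by apply sqrt_pos.
  pose proof (H2_norm_ge0 f) as Hf.
  assert (HfZ : 0 <= H2_norm f * (1 + Z)) by (apply Rmult_le_pos; lra).
  set (d' := d / (H2_norm f * (1 + Z) + 1)).
  assert (Hd' : 0 < d') by (apply Rdiv_lt_0_compat; lra).
  destruct (taylor_error a rho R1 d') as [M HM]; try (unfold R1; lra).
  assert (Hr : 0 < rho / R1 < 1).
  { split; [apply Rdiv_lt_0_compat; unfold R1; lra|].
    apply Rmult_lt_reg_r with R1; [unfold R1; lra|].
    unfold Rdiv; rewrite Rmult_assoc, Rinv_l; unfold R1; lra. }
  destruct (pow_lt_1_zero (rho / R1)) with (y := d') as [n Hn];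
    [rewrite Rabs_pos_eq; lra | exact Hd' |].
  specialize (Hn n (Nat.le_refl n)).
  rewrite Rabs_pos_eq in Hn by (apply Rlt_le, pow_lt, Hr).
  exists (fun s => csum (fun k => taylor_coef a M k f * (phi s - RtoC a) ^ k)%C n).
  split; [now apply (approximable_power_sum _ rho)|].
  intros s Hs; rewrite Cmod_minus_sym.
  eapply Rle_trans; [apply HM, Hb, Hs|]; fold Z.
  apply Rle_trans with (H2_norm f * (d' + d' * Z)).
  - apply Rmult_le_compat_l; [exact Hf|].
    apply Rplus_le_compat_l, Rmult_le_compat_r; lra.
  - apply Rle_trans with ((H2_norm f * (1 + Z) + 1) * d'); [nra|].
    right; unfold d'; field; lra.
Qed.

Lemma approximable_dirichlet (c : nat -> C) :
  (forall eps, 0 < eps -> dirichlet_cv_unif c (halfplane eps)) ->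
  approximable (dirichlet c).
Proof.
  intros H eps d He Hd; destruct (H eps He d Hd) as [N HN].
  exists (fun s => csum (dirichlet_term c s) (S N)); split.
  - exists c, (S N); reflexivity.
  - intros s Hs; rewrite <- csum_sum_n; now apply Rlt_le, HN.
Qed.

(** The error f o phi minus its Taylor polynomial is approximable and bounded on Re s > 0, so it is
    represented by some e of norm at most its bound. On Re s > 1/2 the values of e and of [T f]
    minus the truncation coincide, and [H2_eval_inj] makes them equal. *)
Lemma composition_finite_rank_approx (phi : C -> C) (T : H2 -> H2) (a rho R1 d : R)
  (v : nat -> H2) (n : nat) :
  approximable phi -> is_composition_operator phi T ->
  (forall s, 0 < Re s -> Cmod (phi s - RtoC a) <= rho) ->
  0 < rho -> rho <= R1 -> 1 / 2 < a - R1 -> 0 < d ->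
  (forall k s, 1 / 2 < Re s -> H2_eval (v k) s = ((phi s - RtoC a) ^ k)%C) ->
  exists M, forall f,
    H2_norm (H2_plus (T f) (H2_opp (finite_rank (taylor_coef a M) v n f))) <=
    H2_norm f * (d + (rho / R1) ^ n * zeta_const (a - R1)).
Proof.
  intros Hphi [_ HT] Hb Hrho HR Ha Hd Hv.
  destruct (taylor_error a rho R1 d Hrho HR Ha Hd) as [M HM]; exists M; intros f.
  (* The difference is written as a sum with negated coefficients, the form to which
     [approximable_plus] and [approximable_power_sum] apply. *)
  destruct (approximable_H2 (fun s => H2_eval f (phi s) +
    csum (fun k => - taylor_coef a M k f * (phi s - RtoC a) ^ k) n)%C
    (H2_norm f * (d + (rho / R1) ^ n * zeta_const (a - R1)))) as [e [He1 He2]].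
  - apply approximable_plus.
    + apply (approximable_comp phi a rho); [lra | exact Hphi | exact Hb].
    + apply (approximable_power_sum (fun s => phi s - RtoC a)%C rho
        (fun k => - taylor_coef a M k f)%C); [exact Hb|].
      apply approximable_plus; [exact Hphi | apply approximable_const].
  - intros s Hs.
    rewrite (psum_ext _ _ _
      (fun k => RtoC (-1) * (taylor_coef a M k f * (phi s - RtoC a) ^ k))%C)
      by (intros; ring).
    rewrite csum_scal; eapply Rle_trans; [right|apply (HM f (phi s) n), Hb, Hs].
    f_equal; ring.
  - replace (H2_plus (T f) _) with e; [exact He1|].
    assert (E : T f = H2_plus (finite_rank (taylor_coef a M) v n f) e).
    { apply H2_eval_inj; intros s Hs; rewrite HT by exact Hs.
      rewrite H2_eval_plus, He2 by exact Hs.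
      unfold finite_rank; rewrite H2_eval_hsum by exact Hs.
      rewrite (psum_ext _ _ _
        (fun k => taylor_coef a M k f * (phi s - RtoC a) ^ k)%C)
        by (intros; rewrite H2_eval_scal, Hv by exact Hs; reflexivity).
      rewrite (psum_ext _ _ (fun k => - taylor_coef a M k f * _)%C
        (fun k => RtoC (-1) * (taylor_coef a M k f * (phi s - RtoC a) ^ k))%C)
        by (intros; ring).
      rewrite csum_scal; ring. }
    rewrite E; apply H2_ext; intros k; simpl; ring.
Qed.

Theorem mainTheorem6 (c : nat -> C) (Cphi : H2 -> H2)
  (hunif : forall eps, 0 < eps -> dirichlet_cv_unif c (halfplane eps))
  (hcomp : is_composition_operator (dirichlet c) Cphi)
  (hbounded : is_linear Cphi)
  (hcompact : compact_set
     (closure_set (image_set (dirichlet c) (halfplane 0))))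
  (hsub : forall w,
     closure_set (image_set (dirichlet c) (halfplane 0)) w ->
     halfplane (1/2) w) :
  exists r M : R, 0 < r < 1 /\
    forall n : nat, (1 <= n)%nat ->
      Rbar_le (approx_num Cphi n) (Finite (M * r ^ n)).
Proof.
  destruct (compact_in_disc _ hcompact hsub) as [a [rho [Hrho Hdisc]]].
  set (phi := dirichlet c) in *.
  assert (Hb : forall s, 0 < Re s -> Cmod (phi s - RtoC a) <= rho).
  { intros s Hs; apply Hdisc; intros e; exists (phi s); split.
    - apply ball_center.
    - now exists s. }
  pose proof (approximable_dirichlet c hunif) as Hphi; fold phi in Hphi.
  assert (Hpsi : approximable (fun s => phi s - RtoC a)%C)
    by (apply approximable_plus; [exact Hphi | apply approximable_const]).
  destruct (choice (fun k (e : H2) => forall s, 1 / 2 < Re s ->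
    H2_eval e s = ((phi s - RtoC a) ^ k)%C)) as [v Hv].
  { intros k; destruct (approximable_H2 (fun s => (phi s - RtoC a) ^ k)%C (rho ^ k))
      as [e [_ He]]; [|intros s Hs|now exists e].
    - now apply (approximable_pow (fun s => phi s - RtoC a)%C rho).
    - rewrite Cmod_pow; apply pow_incr; split; [apply Cmod_ge_0 | now apply Hb]. }
  (* The midpoint gives both rho < R1, hence a ratio below 1, and a - R1 > 1/2, hence a finite
     [zeta_const]. *)
  set (R1 := (rho + (a - 1 / 2)) / 2).
  assert (Hr : 0 < rho / R1 < 1).
  { split; [apply Rdiv_lt_0_compat; unfold R1; lra|].
    apply Rmult_lt_reg_r with R1; [unfold R1; lra|].
    unfold Rdiv; rewrite Rmult_assoc, Rinv_l; unfold R1; lra. }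
  set (r := rho / R1) in *; set (Z := zeta_const (a - R1)).
  (* An operator with n terms has rank below n + 1 and error at most (1 + Z) r^n; dividing by r
     compensates for this shift of index. *)
  exists r, ((1 + Z) / r); split; [exact Hr|]; intros n Hn.
  destruct n as [|n]; [lia|].
  assert (Hrn : 0 < r ^ n) by (apply pow_lt, Hr).
  (* The cutoff tolerance is set to r^n, the same size as the Taylor error. *)
  destruct (composition_finite_rank_approx phi Cphi a rho R1 (r ^ n) v n)
    as [M HM]; try assumption; try (unfold R1; lra).
  fold r Z in HM.
  apply (approx_num_le Cphi (finite_rank (taylor_coef a M) v n)).
  - apply finite_rank_is_linear; intros k;
      [apply taylor_coef_linear | apply taylor_coef_bounded].
  - apply finite_rank_rank_lt; intros k; apply taylor_coef_linear.
  - intros f Hf; change (H2_norm f <= 1) in Hf.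
    apply Rle_trans with (1 := HM f).
    assert (0 <= Z) by apply sqrt_pos.
    apply Rle_trans with (1 * (r ^ n + r ^ n * Z)).
    + apply Rmult_le_compat_r; [|exact Hf].
      pose proof (Rmult_le_pos _ _ (Rlt_le _ _ Hrn) H); lra.
    + right; simpl; field; lra.
Qed.
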